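(* Let $P\subset\mathbb{R}^n$ be a rational polytope with $\dim P\ge 1$, and let $v\in P$. Then $$\operatorname{Vol}(P)=\sum_{F\text{ facet of }P}\operatorname{Ht}_F(v)\,\operatorname{Vol}(F),$$ where $\operatorname{Vol}$ denotes lattice normalized volume and $\operatorname{Ht}_F(v)$ the lattice height of $v$ over $F$.
   Context: A polytope is the convex hull of finitely many points $v_1,\dots,v_m\in\mathbb{R}^n$; it is rational if its vertices lie in $\mathbb{Q}^n$. $\operatorname{aff}(X)$ denotes the affine hull, and $\dim P=\dim\operatorname{aff}(P)$. Facets are the maximal proper faces. Lattice (normalized) volume. Let $P$ be a rational polytope, $A=\operatorname{aff}(P)$, $d=\dim P$. If $0\in A$, then $L=A\cap\mathbb{Z}^n$ is a subgroup of $\mathbb{Z}^n$ of rank $d$; choose a $\mathbb{Z}$-basis $u_1,\dots,u_d$ of $L$. The lattice volume $\operatorname{Vol}$ on $A$ is the Lebesgue measure on $A$ scaled so that the simplex $\operatorname{conv}(0,u_1,\dots,u_d)$ has measure $1$ (this is independent of the basis). If $0\notin A$, replace $A$ by a translate $A-w$ with $w\in A$ and set $\operatorname{Vol}(X)=\operatorname{Vol}(X-w)$ for $X\subset A$ (independent of $w$). A single rational point has lattice volume $1$. The volume of a polytope is always taken in its own affine hull. Lattice height. Let $H\ne\emptyset$ be a rational affine subspace of $\mathbb{R}^n$ and $x\in\mathbb{R}^n$ a point such that $A=\operatorname{aff}(H\cup\{x\})$ is a rational affine subspace. If $x\in H$, set $\operatorname{Ht}_H(x)=0$. Otherwise $H$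 is a hyperplane in $A$. If $0\in A$, then $H$ is cut out from $A$ by an equation $\lambda(y)=\beta$, where $\lambda$ is a primitive $\mathbb{Z}$-linear form on $L=A\cap\mathbb{Z}^n$ (primitive means that $\lambda(y)=1$ for some $y\in L$), extended linearly to $A$; set $\operatorname{Ht}_H(x)=|\lambda(x)-\beta|$. If $0\notin A$, choose $w\in A$ and replace $A,H,x$ by $A-w,H-w,x-w$. For a nonempty face $F$ of a rational polytope, $\operatorname{Ht}_F(x)=\operatorname{Ht}_{\operatorname{aff}(F)}(x)$. *)

(* Defs.v *)
(* MathComp-Analysis; points of R^n are row vectors 'rV[R]_n over R : realType. *)
From HB Require Import structures.
From mathcomp Require Import all_boot all_order all_algebra.
From mathcomp Require Import all_classical all_reals all_analysis.

Set Implicit Arguments.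
Unset Strict Implicit.
Unset Printing Implicit Defensive.

Import Order.TTheory GRing.Theory Num.Theory.

Local Open Scope classical_set_scope.
Local Open Scope ring_scope.

Section Polytopes.
Context {R : realType} {n : nat}.
Implicit Types (X P F : set 'rV[R]_n) (x w : 'rV[R]_n).

Definition conv_hull X : set 'rV[R]_n :=
  [set x | exists (k : nat) (p : 'I_k -> 'rV[R]_n) (c : 'I_k -> R),
     [/\ forall i, X (p i), forall i, 0 <= c i,
         \sum_(i < k) c i = 1 & x = \sum_(i < k) c i *: p i]].

Definition aff_hull X : set 'rV[R]_n :=
  [set x | exists (k : nat) (p : 'I_k -> 'rV[R]_n) (c : 'I_k -> R),
     [/\ forall i, X (p i),
         \sum_(i < k) c i = 1 & x = \sum_(i < k) c i *: p i]].

(* The dimension of the linear space directing aff_hull X; the default value 0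
   is only reached for X = set0. *)
Definition aff_dim X : nat :=
  xget 0%N [set d | exists (w : 'rV[R]_n) (V : {vspace 'rV[R]_n}),
                      aff_hull X = [set w + y | y in [set` V]] /\ \dim V = d].

Definition polytope P : Prop :=
  exists (m : nat) (p : 'I_m -> 'rV[R]_n), P = conv_hull (range p).

(* The zero form gives the two improper cases F = P and F = set0. *)
Definition face P F : Prop :=
  exists (f : {scalar 'rV[R]_n}) (b : R),
    (forall x, P x -> f x <= b) /\ F = P `&` [set x | f x = b].

Definition proper_face P F : Prop := face P F /\ F <> P.

Definition facets P : set (set 'rV[R]_n) :=
  [set F | proper_face P F /\
           forall G, proper_face P G -> F `<=` G -> G = F].

Definition vertex P x : Prop := face P [set x].

Definition rational_polytope P : Prop :=
  polytope P /\
  forall x, vertex P x -> exists q : 'rV[rat]_n, x = map_mx ratr q.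

End Polytopes.

(* Lebesgue measure on R^d, as the d-fold product of lebesgue_measure
   (Dirac mass on the one-point space R^0). *)
Fixpoint lebesgue_tuple (R : realType) (d : nat) :
    set (d.-tuple (measurableTypeR R)) -> \bar R :=
  match d with
  | 0 => dirac [tuple]
  | d'.+1 => pushforward
      (product_measure1 (@lebesgue_measure R) (@lebesgue_tuple R d'))
      (fun xt : measurableTypeR R * d'.-tuple (measurableTypeR R) =>
         [tuple of xt.1 :: xt.2])
  end.

Section Lattice.
Context {R : realType} {n : nat}.
Implicit Types (A B H X F : set 'rV[R]_n) (x w : 'rV[R]_n).

Definition base_point A : 'rV[R]_n :=
  if pselect (A 0) then 0 else xget 0 A.

Definition recenter A w : set 'rV[R]_n := [set y - w | y in A].

Definition lattice_points B : set 'rV[int]_n := [set z | B (map_mx intr z)].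

(* The rows of U form a Z-basis of L: each element of L has a unique expression
   as an integer combination of them, and all such combinations are in L. *)
Definition Zbasis d (L : set 'rV[int]_n) (U : 'M[int]_(d, n)) : Prop :=
  set_bij [set: 'rV[int]_d] L (fun c => c *m U).

(* Lebesgue measure of Y transported to R^d by the linear coordinates
   t |-> \sum_i t_i u_i, where u_i is the i-th row of U. *)
Definition coord_measure d (U : 'M[int]_(d, n)) (Y : set 'rV[R]_n) : R :=
  fine (lebesgue_tuple
    [set t | Y (\sum_(i < d) (tnth t i : R) *: map_mx intr (row i U))]).

Definition unit_simplex d (U : 'M[int]_(d, n)) : set 'rV[R]_n :=
  conv_hull (0 |` range (fun i : 'I_d => map_mx intr (row i U))).

Definition lattice_volume X : R :=
  let A := aff_hull X in
  let w := base_point A in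
  let U := xget (0 : 'M[int]_(aff_dim X, n))
                (Zbasis (lattice_points (recenter A w))) in
  coord_measure U (recenter X w) / coord_measure U (unit_simplex U).

(* f stands for the linear extension of a primitive Z-linear form on L; only
   its values on the span of L matter below. *)
Definition primitive_form (L : set 'rV[int]_n) (f : {scalar 'rV[R]_n}) : Prop :=
  (forall z, L z -> f (map_mx intr z) \is a Num.int) /\
  (exists2 z, L z & f (map_mx intr z) = 1).

(* xget selects the value |f (x - w) - b|, which does not depend on the
   equation f y = b chosen for H - w in A - w. *)
Definition lattice_height_aff H x : R :=
  if pselect (H x) then 0 else
  let A := aff_hull (x |` H) in
  let w := base_point A in
  xget 0 [set h | exists (f : {scalar 'rV[R]_n}) (b : R),
    [/\ primitive_form (lattice_points (recenter A w)) f,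
        recenter H w = recenter A w `&` [set y | f y = b]
      & h = `|f (x - w) - b| ]].

Definition lattice_height F x : R := lattice_height_aff (aff_hull F) x.

End Lattice.

(* Main.v *)
Require Import Defs.
From HB Require Import structures.
From mathcomp Require Import all_boot all_order all_algebra.
From mathcomp Require Import all_classical all_reals all_analysis.
From mathcomp Require Import measurable_realfun.
From mathcomp Require Import ring lra zify.

Set Implicit Arguments.
Unset Strict Implicit.
Unset Printing Implicit Defensive.

Import Order.TTheory GRing.Theory Num.Theory.
Import numFieldNormedType.Exports.

Local Open Scope classical_set_scope.
Local Open Scope ring_scope.

(** The segments from v to the points of a facet F fill the pyramid [cone v F].
    These pyramids cover P, since the ray from v through a point of P leaves P in
    a facet ([facet_cones_cover]), and two of them overlap in a null set
    ([facet_cones_overlap], [cone_in_hyperplane]). Hence Vol(P) is the sum of the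
    volumes of the pyramids, and it remains to see that the pyramid over F has
    lattice volume Ht_F(v) Vol(F).

    If v lies in the affine hull of F, both are zero. Otherwise let f be the
    primitive form that cuts out F, let W be a lattice basis for F and z0 a lattice
    point with f(z0) = 1. Then (z0, W) is a lattice basis for P
    ([adapted_basis]). In the corresponding coordinates with origin v, the first
    coordinate is f - f(v) and the slice of the pyramid at x is a translate of the
    base scaled by x/h, where |h| = Ht_F(v). Integrating |x/h|^(d-1) over the
    slices gives |h|/d times the measure of the base ([lebesgue_rV_cone]), and
    the normalizing factors d! for P and (d-1)! for F absorb the 1/d
    ([lebesgue_rV_chart_facet_cone]).

    Three bodies of facts support this argument.
    - Measure theory: Lebesgue measure, defined by iterated integrals, is scaled by
      |det A| under an invertible matrix A ([lebesgue_rV_linear]). So the choice of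
      a lattice basis does not matter, and the volume of a polytope may be computed
      in any lattice coordinates ([lattice_volume_chart]).
    - Lattices: Smith's normal form yields lattice bases of rational subspaces
      ([rational_rowspace]) and primitive forms for rational hyperplanes
      ([primitive_form_hyperplane]).
    - Polytopes: Fourier-Motzkin elimination describes a polytope by finitely many
      inequalities ([conv_halfspaces]). These separate a point from a polytope, so
      that P is generated by its vertices, which are rational
      ([rational_generators]); they also show how a ray leaves P ([exit_face]). A
      facet, being a maximal proper face, spans a hyperplane of the affine hull of
      P, since otherwise its supporting hyperplane could be tilted
      ([facet_hyperplane]). *)

Local Notation intmx R := (map_mx (intr : int -> R)).

(** * The iterated Lebesgue measure is a measure *)

Section LebesgueTuple.
Context {R : realType}.
Local Notation T := (measurableTypeR R).

Definition tcons d (xt : T * d.-tuple T) : d.+1.-tuple T :=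
  [tuple of xt.1 :: xt.2].

Lemma measurable_tcons d : measurable_fun [set: T * d.-tuple T] (@tcons d).
Proof. exact: measurable_cons. Qed.

Lemma measurable_tuncons d :
  measurable_fun [set: d.+1.-tuple T]
    (fun t : d.+1.-tuple T => (thead t, [tuple of behead t]) : T * d.-tuple T).
Proof.
apply: measurable_fun_pair; last exact: measurable_behead.
exact: measurable_tnth.
Qed.

Lemma sigma_finite_measure_packing disp (X : measurableType disp)
    (nu : set X -> \bar R) :
  nu set0 = 0%E -> (forall A, (0 <= nu A)%E) -> semi_sigma_additive nu ->
  sigma_finite setT nu ->
  exists mu : {sigma_finite_measure set X -> \bar R}, nu = mu.
Proof.
move=> nu0 nuge nus nuf.
pose nu1 := isMeasure.Build _ _ _ nu nu0 nuge nus.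
pose nu2 : {measure set X -> \bar R} := HB.pack nu nu1.
pose nu3 := Measure_isSigmaFinite.Build _ _ _ nu2 nuf.
pose nu4 : {sigma_finite_measure set X -> \bar R} := HB.pack nu nu1 nu3.
by exists nu4.
Qed.

(** The product of two sigma-finite measures is sigma-finite, and the bijection
    (x, t) |-> x :: t is measurable in both directions, so the structure passes
    from dimension d to dimension d + 1. *)
Lemma lebesgue_tuple_measureP d :
  exists mu : {sigma_finite_measure set (d.-tuple T) -> \bar R},
    @lebesgue_tuple R d = mu.
Proof.
elim: d => [|d [mu IH]].
  by exists (\d_([tuple] : 0.-tuple T)).
pose f := @tcons d.
have mf := @measurable_tcons d.
pose nu := pushforward (@lebesgue_measure R \x mu)%E f.
have E : @lebesgue_tuple R d.+1 = nu by rewrite /= IH.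
have nu0 : nu set0 = 0%E by rewrite /nu /pushforward preimage_set0 measure0.
have nuge A : (0 <= nu A)%E by exact: measure_ge0.
have nus : semi_sigma_additive nu.
  move=> F mF tF mUF; rewrite /nu /pushforward preimage_bigcup.
  apply: measure_semi_sigma_additive.
  - by move=> n; rewrite -[X in measurable X]setTI; exact: mf.
  - apply/trivIsetP => i j _ _ ij; rewrite -preimage_setI.
    by move/trivIsetP : tF => -> //; rewrite preimage_set0.
  - by rewrite -preimage_bigcup -[X in measurable X]setTI; exact: mf.
have nuf : sigma_finite setT nu.
  have /sigma_finiteP[F [TF ndF Foo]] := sigma_finiteT (@lebesgue_measure R).
  have /sigma_finiteP[G [TG ndG Goo]] := sigma_finiteT mu.
  exists (fun n => [set t | F n (thead t) /\ G n [tuple of behead t]]).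
    apply/esym/seteqP; split => // t _.
    have [i _ Fi] : (\bigcup_i F i) (thead t) by rewrite -TF.
    have [j _ Gj] : (\bigcup_i G i) [tuple of behead t] by rewrite -TG.
    exists (maxn i j) => //; split.
      by move/subsetPset : (ndF _ _ (leq_maxl i j)); exact.
    by move/subsetPset : (ndG _ _ (leq_maxr i j)); exact.
  move=> n; have [mFn Fnoo] := Foo n; have [mGn Gnoo] := Goo n; split.
    have := @measurable_tuncons d measurableT _ (measurableX mFn mGn).
    by rewrite setTI.
  rewrite /nu /pushforward (_ : f @^-1` _ = F n `*` G n).
    by rewrite product_measure1E// lte_mul_pinfty// ge0_fin_numE.
  apply/seteqP; split => -[x t] /=.
    move=> [Fx Gt]; split => //=.
    by rewrite (_ : t = [tuple of behead [tuple of x :: t]])//; exact: val_inj.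
  move=> [Fx Gt]; split => //=.
  by rewrite (_ : [tuple of _] = t)//; exact: val_inj.
by rewrite E; exact: sigma_finite_measure_packing.
Qed.

Lemma lebesgue_tuple0 d : @lebesgue_tuple R d set0 = 0%E.
Proof. by have [mu ->] := lebesgue_tuple_measureP d; exact: measure0. Qed.
Lemma lebesgue_tuple_ge0 d A : (0 <= @lebesgue_tuple R d A)%E.
Proof. by have [mu ->] := lebesgue_tuple_measureP d; exact: measure_ge0. Qed.
Lemma lebesgue_tuple_sigma_additive d : semi_sigma_additive (@lebesgue_tuple R d).
Proof.
have [mu ->] := lebesgue_tuple_measureP d; exact: measure_semi_sigma_additive.
Qed.
HB.instance Definition _ d := isMeasure.Build _ _ _ (@lebesgue_tuple R d)
  (@lebesgue_tuple0 d) (@lebesgue_tuple_ge0 d) (@lebesgue_tuple_sigma_additive d).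
Lemma lebesgue_tuple_sigma_finite d : sigma_finite setT (@lebesgue_tuple R d).
Proof. have [mu ->] := lebesgue_tuple_measureP d; exact: sigma_finiteT. Qed.
HB.instance Definition _ d := Measure_isSigmaFinite.Build _ _ _
  (@lebesgue_tuple R d) (@lebesgue_tuple_sigma_finite d).

End LebesgueTuple.

(** * Lebesgue measure of sets of row vectors *)

Section AffineSubstitution.
Context {R : realType}.
Local Notation mu := (@lebesgue_measure R).

(** The image of Lebesgue measure under x |-> a x + b and its multiple by 1/|a|
    agree on half-open intervals, hence everywhere. *)
Lemma ge0_integral_affine (a b : R) (g : measurableTypeR R -> \bar R) : a != 0 ->
  measurable_fun setT g -> (forall x, 0 <= g x)%E ->
  (\int[mu]_x g (a * x + b)%R = `|a|^-1%:E * \int[mu]_x g x)%E.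
Proof.
move=> a0 mg g0.
pose phi : measurableTypeR R -> measurableTypeR R := fun x => a * x + b.
have mphi : measurable_fun setT phi.
  by apply: measurable_funD => //; exact: measurable_funM.
have na0 : 0 < `|a| by rewrite normr_gt0.
have na : 0 <= `|a| by exact: ltW.
have phiE A : measurable A -> mu A = (mscale (NngNum na) (pushforward mu phi)) A.
  apply: lebesgue_measure_unique => _ [[x y]] _ <-.
  rewrite lebesgue_measure_itv/=.
  transitivity (`|a|%:E * mu (phi @^-1` `]x, y]))%E; last by [].
  have [agt0|ale0] := ltP 0 a.
    rewrite (_ : phi @^-1` _ = `](x - b) / a, (y - b) / a]%classic); last first.
      apply/seteqP; split => z /=; rewrite /phi !in_itv/= ltr_pdivrMr// ler_pdivlMr//;
        rewrite ltrBlDr lerBrDr mulrC//.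
    rewrite lebesgue_measure_itv/= !lte_fin ltr_pM2r ?invr_gt0// ltrD2r.
    case: ifPn => _; last by rewrite mule0.
    by rewrite -EFinB -EFinM gtr0_norm//; congr EFin; field.
  have alt0 : a < 0 by rewrite lt_neqAle a0.
  rewrite (_ : phi @^-1` _ = `[(y - b) / a, (x - b) / a[%classic); last first.
    apply/seteqP; split => z /=; rewrite /phi !in_itv/= ler_ndivrMr// ltr_ndivlMr//;
      rewrite ltrBlDr lerBrDr mulrC andbC//.
  rewrite lebesgue_measure_itv/= !lte_fin ltr_nM2r ?invr_lt0// ltrD2r.
  case: ifPn => _; last by rewrite mule0.
  by rewrite -EFinB -EFinM ltr0_norm//; congr EFin; field.
rewrite [X in (_ * X)%E](_ : _ =
    \int[mscale (NngNum na) (pushforward mu phi)]_x g x)%E; last first.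
  by apply: eq_measure_integral => A mA _; exact: phiE.
rewrite ge0_integral_mscale//= muleA -EFinM mulVf ?gt_eqF// mul1e.
by rewrite ge0_integral_pushforward//= preimage_setT.
Qed.
End AffineSubstitution.

Section LebesgueRows.
Context {R : realType}.
Local Notation T := (measurableTypeR R).
Local Notation mu := (@lebesgue_measure R).

Definition tuple_row d (t : d.-tuple T) : 'rV[R]_d := \row_i tnth t i.
(** Lebesgue measure is defined on tuples, whereas matrices act on row vectors:
    [lebesgue_rV] and [measurable_rV] carry the measure and its sigma-algebra
    over to sets of row vectors. *)
Definition lebesgue_rV d (S : set 'rV[R]_d) : \bar R :=
  lebesgue_tuple [set t | S (tuple_row t)].
Definition measurable_rV d (S : set 'rV[R]_d) := measurable [set t | S (tuple_row t)].
Definition row_cons d (x : R) (y : 'rV[R]_d) : 'rV[R]_d.+1 := row_mx (x%:M : 'rV_1) y.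

Lemma row_cons0 d (x : R) (y : 'rV[R]_d) : row_cons x y 0 ord0 = x.
Proof.
rewrite (_ : ord0 = lshift d (ord0 : 'I_1)); last exact: val_inj.
by rewrite (@row_mxEl _ 1 1 d) mxE.
Qed.

Lemma row_consS d (x : R) (y : 'rV[R]_d) j : row_cons x y 0 (lift ord0 j) = y 0 j.
Proof.
rewrite (_ : lift ord0 j = rshift 1 j); last exact: val_inj.
by rewrite (@row_mxEr _ 1 1 d).
Qed.

Lemma tuple_row_cons d (x : R) (t : d.-tuple T) :
  tuple_row [tuple of x :: t] = row_cons x (tuple_row t).
Proof.
apply/rowP => i; case: (unliftP ord0 i) => [j|] ->.
  by rewrite row_consS !mxE tnthS.
by rewrite row_cons0 mxE.
Qed.

(** One step of the iterated integral: slice by the first coordinate. All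
    inductions on the dimension go through this identity. *)
Lemma lebesgue_rV_sections d (S : set 'rV[R]_d.+1) :
  lebesgue_rV S = (\int[mu]_x lebesgue_rV [set y | S (row_cons x y)])%E.
Proof.
rewrite /lebesgue_rV /= /pushforward /product_measure1.
apply: eq_integral => x _ /=; congr lebesgue_tuple.
by apply/seteqP; split => t; rewrite /xsection/= inE/= tuple_row_cons.
Qed.

Lemma lebesgue_rV_ge0 d (S : set 'rV[R]_d) : (0 <= lebesgue_rV S)%E.
Proof. exact: measure_ge0. Qed.

Lemma measurable_rV_section d (S : set 'rV[R]_d.+1) x :
  measurable_rV S -> measurable_rV [set y | S (row_cons x y)].
Proof.
move=> mS; rewrite /measurable_rV.
pose g := fun t : d.-tuple T => [tuple of x :: t].
have mg : measurable_fun setT g by exact: measurable_cons.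
have := mg measurableT _ mS; rewrite setTI; congr measurable.
by apply/seteqP; split => t /=; rewrite tuple_row_cons.
Qed.

Lemma measurable_lebesgue_section d (S : set 'rV[R]_d.+1) : measurable_rV S ->
  measurable_fun setT (fun x : T => lebesgue_rV [set y | S (row_cons x y)]).
Proof.
move=> mS.
have := measurable_fun_xsection (@lebesgue_tuple R d)
  (@measurable_tcons R d measurableT _ mS).
apply: eq_measurable_fun => x _ /=; congr lebesgue_tuple.
by apply/seteqP; split => t; rewrite /xsection/= setTI inE/= tuple_row_cons.
Qed.

Lemma measurable_row_comp disp (X : measurableType disp) d (f : X -> 'rV[R]_d) :
  (forall i, measurable_fun setT (fun x => f x 0 i : T)) ->
  forall S, measurable_rV S -> measurable [set x | S (f x)].
Proof.
move=> mf S mS.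
pose g := fun x => [tuple f x 0 i | i < d] : d.-tuple T.
have mg : measurable_fun setT g.
  apply/measurable_fun_tnthP => i; apply: eq_measurable_fun (mf i) => x _ /=.
  by rewrite tnth_mktuple.
have := mg measurableT _ mS; rewrite setTI; congr measurable.
apply/seteqP; split => x /=; rewrite (_ : tuple_row (g x) = f x)//.
  by apply/rowP => i; rewrite !mxE tnth_mktuple.
by apply/rowP => i; rewrite !mxE tnth_mktuple.
Qed.

Lemma measurable_linform d (a : 'I_d -> R) (b : R) :
  measurable_fun setT (fun t : d.-tuple T => \sum_i tnth t i * a i + b : T).
Proof.
apply: measurable_funD => //; apply: measurable_sum => i.
by apply: measurable_funM => //; exact: measurable_tnth.
Qed.

Lemma measurable_rV_affine d e (M : 'M[R]_(d, e)) (c : 'rV[R]_e) (S : set 'rV[R]_e) :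
  measurable_rV S -> measurable_rV [set y | S (y *m M + c)].
Proof.
move=> mS; apply: (measurable_row_comp (f := fun t => tuple_row t *m M + c)) => // i.
apply: eq_measurable_fun (measurable_linform (M ^~ i) (c 0 i)) => t _.
by rewrite !mxE; congr (_ + _); apply: eq_bigr => j _; rewrite mxE.
Qed.

Lemma measurable_rV_halfspace d (a : 'cV[R]_d) (b : R) :
  measurable_rV [set y | (y *m a) 0 0 <= b].
Proof.
have := measurable_linform (a ^~ 0) 0 measurableT (measurable_itv `]-oo, b]).
rewrite setTI; congr measurable.
have E t : (tuple_row t *m a) 0 0 = \sum_i tnth t i * a i 0 + 0.
  by rewrite mxE addr0; apply: eq_bigr => j _; rewrite mxE.
by apply/seteqP; split => t /=; rewrite in_itv/= E.
Qed.
(** * Affine and linear changes of variables *)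

Definition row_behead d (c : 'rV[R]_d.+1) : 'rV[R]_d := \row_j c 0 (lift ord0 j).

Lemma row_cons_behead d (c : 'rV[R]_d.+1) : row_cons (c 0 ord0) (row_behead c) = c.
Proof.
apply/rowP => i; case: (unliftP ord0 i) => [j|] ->; last by rewrite row_cons0.
by rewrite row_consS mxE.
Qed.

Lemma row_consD d x x' (y y' : 'rV[R]_d) :
  row_cons x y + row_cons x' y' = row_cons (x + x') (y + y').
Proof.
apply/rowP => i; rewrite mxE.
case: (unliftP ord0 i) => [j|] ->; last by rewrite !row_cons0.
by rewrite !row_consS !mxE.
Qed.

Lemma row_consZ d a x (y : 'rV[R]_d) : a *: row_cons x y = row_cons (a * x) (a *: y).
Proof.
apply/rowP => i; rewrite mxE.
case: (unliftP ord0 i) => [j|] ->; last by rewrite !row_cons0.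
by rewrite !row_consS !mxE.
Qed.

(** Each slice is scaled and translated in dimension d, and the parameter of the
    slices undergoes the affine substitution x |-> a x + c_0 on the line. *)
Lemma lebesgue_rV_scale d (a : R) (c : 'rV[R]_d) (S : set 'rV[R]_d) :
  a != 0 -> measurable_rV S ->
  lebesgue_rV [set y | S (a *: y + c)] = ((`|a|^-1 ^+ d)%:E * lebesgue_rV S)%E.
Proof.
move=> a0; elim: d c S => [|d IH] c S mS.
  rewrite expr0 mul1e; congr lebesgue_rV; apply/seteqP; split => y /=;
  by rewrite (_ : a *: y + c = y)//; apply/rowP => -[].
rewrite !lebesgue_rV_sections -ge0_integralZl_EFin//; last exact: measurable_lebesgue_section.
set L := fun x => lebesgue_rV [set y | S (row_cons x y)].
pose G (z : T) := ((`|a|^-1 ^+ d)%:E * L z)%E.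
transitivity (\int[mu]_x G (a * x + c 0 ord0)%R)%E.
  apply: eq_integral => x _; rewrite /G /L /=.
  rewrite -(IH (row_behead c)); last exact: measurable_rV_section.
  have E y : a *: row_cons x y + c = row_cons (a * x + c 0 ord0) (a *: y + row_behead c).
    by rewrite row_consZ -[in LHS](row_cons_behead c) row_consD.
  by congr lebesgue_rV; apply/seteqP; split => y /=; rewrite E.
rewrite (@ge0_integral_affine R a _ G a0); last 2 first.
- by apply: measurable_funeM; exact: measurable_lebesgue_section.
- by move=> x; rewrite mule_ge0 ?lebesgue_rV_ge0// lee_fin exprn_ge0// invr_ge0.
rewrite -ge0_integralZl_EFin//.
- apply: eq_integral => x _ /=; rewrite muleA -EFinM -exprS//.
- by move=> x _; rewrite mule_ge0 ?lebesgue_rV_ge0// lee_fin exprn_ge0// invr_ge0.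
- by apply: measurable_funeM; exact: measurable_lebesgue_section.
Qed.

Lemma lebesgue_rV_translate d (c : 'rV[R]_d) (S : set 'rV[R]_d) : measurable_rV S ->
  lebesgue_rV [set y | S (y + c)] = lebesgue_rV S.
Proof.
move=> mS; rewrite -[RHS]mul1e.
have := lebesgue_rV_scale c (oner_neq0 R) mS; rewrite normr1 invr1 expr1n => <-.
by under [in RHS]eq_set do rewrite scale1r.
Qed.

(** The property that [lebesgue_rV_linear] establishes for every invertible A; it
    is stable under products and inverses, so generators suffice. *)
Definition det_scaling d (A : 'M[R]_d) := forall S, measurable_rV S ->
  lebesgue_rV [set y | S (y *m A)] = ((`|\det A|^-1)%:E * lebesgue_rV S)%E.

Lemma measurable_rV_linear d e (M : 'M[R]_(d, e)) (S : set 'rV[R]_e) :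
  measurable_rV S -> measurable_rV [set y | S (y *m M)].
Proof.
move=> /(measurable_rV_affine M 0); congr measurable_rV.
by apply/seteqP; split => y /=; rewrite addr0.
Qed.

Lemma det_scalingM d (A B : 'M[R]_d) :
  det_scaling A -> det_scaling B -> det_scaling (A *m B).
Proof.
move=> hA hB S mS; rewrite det_mulmx normrM invfM EFinM -muleA -hB//.
rewrite -hA; last exact: measurable_rV_linear.
by congr lebesgue_rV; apply/seteqP; split => y /=; rewrite mulmxA.
Qed.

Lemma det_scalingV d (A : 'M[R]_d) : A \in unitmx ->
  det_scaling A -> det_scaling (invmx A).
Proof.
move=> uA hA S mS.
have := hA _ (measurable_rV_linear (invmx A) mS).
rewrite (_ : [set _ | _] = S); last first.
  by apply/seteqP; split => y /=; rewrite -mulmxA mulmxV// mulmx1.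
move=> ->; rewrite muleA -EFinM det_inv normfV invrK mulfV ?mul1e//.
by rewrite normr_eq0 -unitfE -unitmxE.
Qed.

Lemma row_cons_mul_block d (x : R) (y : 'rV[R]_d) a (r : 'rV[R]_d) c (A : 'M[R]_d) :
  row_cons x y *m (block_mx a%:M r c A : 'M[R]_(1 + d)) =
  row_cons (x * a + (y *m c) 0 0) (x *: r + y *m A).
Proof.
rewrite /row_cons (@mul_row_block _ 1 1 d 1 d) -!scalar_mxM mul_scalar_mx.
by rewrite {1}[y *m c]mx11_scalar -raddfD.
Qed.

(** The first coordinate of y A depends on that of y only, so A maps slices to
    slices, where it acts as the lower block followed by a translation. *)
Lemma det_scaling_upper d a (r : 'rV[R]_d) (A : 'M[R]_d) : a != 0 ->
  det_scaling A -> det_scaling (block_mx a%:M r 0 A : 'M[R]_(1 + d)).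
Proof.
move=> a0 hA S mS; rewrite !lebesgue_rV_sections.
set L := fun x => lebesgue_rV [set y | S (row_cons x y)].
have mL : measurable_fun setT (L : T -> _) by exact: measurable_lebesgue_section.
have L0 x : (0 <= L x)%E by exact: lebesgue_rV_ge0.
pose G (z : T) := ((`|\det A|^-1)%:E * L z)%E.
transitivity (\int[mu]_x G (a * x + 0)%R)%E.
  apply: eq_integral => x _; rewrite /G /L /=.
  have mSx := measurable_rV_section (a * x + 0) mS.
  rewrite -(lebesgue_rV_translate (x *: r) mSx).
  rewrite -hA; last by have := measurable_rV_affine 1%:M (x *: r) mSx;
    under eq_set do rewrite mulmx1.
  congr lebesgue_rV; apply/seteqP; split => y /=;
  by rewrite (row_cons_mul_block x y a r 0 A) mulmx0 mxE mulrC [_ + x *: r]addrC.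
rewrite (@ge0_integral_affine R a _ G a0); last 2 first.
- exact: measurable_funeM.
- by move=> x; rewrite mule_ge0// lee_fin invr_ge0.
rewrite (@ge0_integralZl_EFin _ _ _ mu)//.
by rewrite muleA -EFinM det_ublock det_scalar1 normrM invfM.
Qed.

(** Fubini: the first coordinate, which the definition integrates last, may be
    integrated first. *)
Lemma lebesgue_rV_fubini d (S : set 'rV[R]_d.+1) : measurable_rV S ->
  lebesgue_rV S =
  (\int[@lebesgue_tuple R d]_t mu [set x | S (row_cons x (tuple_row t))])%E.
Proof.
move=> mS.
rewrite (_ : lebesgue_rV S = product_measure1 mu (@lebesgue_tuple R d)
  (@tcons R d @^-1` [set t | S (tuple_row t)]))//.
have mX : measurable (@tcons R d @^-1` [set t | S (tuple_row t)]).
  by have := @measurable_tcons R d measurableT _ mS; rewrite setTI.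
rewrite (product_measure_unique (m' := product_measure2 mu (@lebesgue_tuple R d)))//.
  apply: eq_integral => t _ /=; congr (mu _).
  by apply/seteqP; split => x; rewrite /ysection/= inE/= tuple_row_cons.
by move=> A B mA mB; exact: product_measure2E.
Qed.

(** The shear translates every line parallel to the first axis, hence preserves
    the integrals over these lines. *)
Lemma det_scaling_shear d (c : 'cV[R]_d) :
  det_scaling (block_mx 1%:M 0 c 1%:M : 'M[R]_(1 + d)).
Proof.
move=> S mS; rewrite det_lblock !det1 mulr1 normr1 invr1 mul1e.
have mS' := measurable_rV_linear (block_mx 1%:M 0 c 1%:M : 'M[R]_(1 + d)) mS.
rewrite (lebesgue_rV_fubini mS) (lebesgue_rV_fubini mS').
apply: eq_integral => t _.
have mSt : measurable [set x : T | S (row_cons x (tuple_row t))].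
  have := measurable_row_comp (f := fun x : T => row_cons x (tuple_row t)) _ mS.
  apply => i.
  case: (unliftP ord0 i) => [j|] ->.
    by under eq_fun do rewrite row_consS; exact: measurable_cst.
  by under eq_fun do rewrite row_cons0; exact: measurable_id.
have E b : mu [set x : T | S (row_cons (x + b) (tuple_row t))] =
   mu [set x : T | S (row_cons x (tuple_row t))].
  have mSb : measurable [set x : T | S (row_cons (x + b) (tuple_row t))].
    have mphi : measurable_fun setT (fun x : T => x + b : T) by exact: measurable_funD.
    by have := mphi measurableT _ mSt; rewrite setTI.
  pose I : T -> R := \1_[set x : T | S (row_cons x (tuple_row t))].
  have mI0 : measurable_fun [set: T] I by exact: measurable_indic.
  have mI : measurable_fun [set: T] (EFin \o I) by exact/measurable_EFinP.
  have := ge0_integral_affine b (oner_neq0 R) mI.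
  have ind (A : set T) : measurable A -> (\int[mu]_x (\1_A x)%:E = mu A)%E.
    by move=> mA; rewrite integral_indic// setIT.
  rewrite normr1 invr1 mul1e -(ind _ mSt) => <- //.
  rewrite -(ind _ mSb).
  apply: eq_integral => x _; rewrite mul1r /= /I !indicE; congr ((nat_of_bool _)%:R%:E).
  by move=> x; rewrite lee_fin /I indicE ler0n.
rewrite -(E ((tuple_row t *m c) 0 0)); congr (mu _).
apply/seteqP; split => x /=;
by rewrite row_cons_mul_block mulr1 scaler0 add0r mulmx1.
Qed.

(** If the corner entry of A is nonzero, one Gauss step writes A as a shear times
    a block triangular matrix, to which induction applies. A zero corner is
    repaired by adding to the first row the combination of the other rows whose
    coefficients are the entries c_i below the corner: it becomes the sum of the
    c_i^2. *)
Lemma lebesgue_rV_linear d (A : 'M[R]_d) : A \in unitmx -> det_scaling A.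
Proof.
elim: d A => [|d IH] A uA.
  move=> S mS; rewrite det_mx00 normr1 invr1 mul1e; congr lebesgue_rV.
  by apply/seteqP; split => y /=; rewrite (_ : y *m A = y)//; apply/rowP => -[].
change ('M[R]_(1 + d)) in A.
have corner (B : 'M[R]_(1 + d)) : B \in unitmx -> ulsubmx B 0 0 != 0 -> det_scaling B.
  move=> uB; set a := ulsubmx B 0 0 => a0.
  set C := drsubmx B - a^-1 *: (dlsubmx B *m ursubmx B).
  have EB : B = block_mx 1%:M 0 (a^-1 *: dlsubmx B) 1%:M *m
      block_mx a%:M (ursubmx B) 0 C.
    rewrite mulmx_block !mul1mx !mul0mx ?mulmx0 !addr0 mul_mx_scalar scalerA.
    rewrite mulfV// scale1r -scalemxAl addrC subrK -{1}(submxK B); congr block_mx.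
    by rewrite {1}[ulsubmx B]mx11_scalar.
  have uC : C \in unitmx.
    move: uB; rewrite !unitmxE EB det_mulmx det_lblock !det1 !mul1r det_ublock.
    by rewrite unitrM => /andP[].
  rewrite EB; apply: det_scalingM; first exact: det_scaling_shear.
  by apply: det_scaling_upper => //; exact: IH.
have [a0|] := eqVneq (ulsubmx A 0 0) 0; last exact: corner.
set c := dlsubmx A.
pose P : 'M[R]_(1 + d) := block_mx 1%:M c^T 0 1%:M.
have uP : P \in unitmx by rewrite unitmxE det_ublock !det1 mulr1 unitr1.
have hP : det_scaling P.
  by apply: det_scaling_upper; [exact: oner_neq0|exact: IH (unitmx1 _ _)].
have -> : A = invmx P *m (P *m A) by rewrite mulmxA mulVmx// mul1mx.
apply: det_scalingM; first exact: det_scalingV.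
apply: corner; first by rewrite unitmx_mul uP.
rewrite /P -{1}(submxK A) mulmx_block block_mxKul mul1mx mxE a0 add0r.
rewrite mxE psumr_eq0; last by move=> i _; rewrite mxE -expr2 sqr_ge0.
apply: contraTN uA => /allP c0.
have c00 : c = 0.
  apply/colP => i; have /implyP := c0 i (mem_index_enum i).
  by rewrite mxE -expr2 sqrf_eq0 [RHS]mxE => /(_ isT)/eqP.
rewrite unitmxE -(submxK A) -/c c00 (@det_ublock _ 1 d) [ulsubmx A]mx11_scalar.
by rewrite a0 det_scalar1 mul0r unitr0.
Qed.

Lemma lebesgue_rV_hyperplane0 d (b : R) :
  lebesgue_rV [set y : 'rV[R]_d.+1 | y 0 ord0 = b] = 0%E.
Proof.
rewrite lebesgue_rV_sections.
rewrite (_ : (fun x => _) = (fun x => lebesgue_rV [set: 'rV[R]_d]) \_ [set b]).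
  by rewrite -integral_mkcond integral_set1.
apply/funext => x; rewrite patchE; case: ifPn => xb.
  move: xb; rewrite inE/= => ->; congr lebesgue_rV; apply/seteqP; split => y//= _.
  by rewrite row_cons0.
rewrite (_ : [set _ | _] = set0); first exact: measure0.
apply/seteqP; split => y//=; rewrite row_cons0 => xbE; case/negP: xb. by rewrite inE.
Qed.

(** * Hyperplanes, boxes, pyramids and simplices *)

Lemma measurable_rV_hyperplane d (a : 'cV[R]_d) (b : R) :
  measurable_rV [set y | (y *m a) 0 0 = b].
Proof.
have := measurableI _ _ (measurable_rV_halfspace a b)
  (measurable_rV_halfspace (- a) (- b)).
congr measurable; apply/seteqP; split => t /=.
  by rewrite mulmxN [X in _ /\ X <= _]mxE lerN2 => -[h1 h2]; apply/le_anti/andP.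
by move=> h; rewrite mulmxN [X in _ /\ X <= _]mxE h; split.
Qed.

(** As the column a has rank one, an invertible change of variables turns it into
    a multiple of the first coordinate; then all slices but one are empty. *)
Lemma lebesgue_rV_hyperplane d (a : 'cV[R]_d) (b : R) : a != 0 ->
  lebesgue_rV [set y | (y *m a) 0 0 = b] = 0%E.
Proof.
case: d a => [|d] a a0; first by move: a0; rewrite (flatmx0 a) eqxx.
have r1 : \rank a = 1%N.
  apply/eqP; rewrite eqn_leq; apply/andP; split; last by rewrite lt0n mxrank_eq0.
  exact: rank_leq_col.
pose s := row_ebase a 0 0.
have aE : a = col_ebase a *m (s *: (delta_mx ord0 0 : 'cV[R]_d.+1)).
  have <- : pid_mx 1 *m row_ebase a = s *: delta_mx ord0 0 :> 'cV[R]_d.+1.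
    rewrite [row_ebase a]mx11_scalar mul_mx_scalar -/s; congr (_ *: _).
    by apply/matrixP => i j; rewrite !mxE !ord1 eqxx !andbT; case: i => -[].
  by have := mulmx_ebase a; rewrite r1 mulmxA => ->.
have s0 : s != 0 by apply: contraNneq a0 => s0; rewrite aE s0 scale0r mulmx0.
have Ey (y : 'rV[R]_d.+1) : (y *m a) 0 0 = s * (y *m col_ebase a) 0 ord0.
  by rewrite [in LHS]aE mulmxA -scalemxAr mxE -colE; congr (_ * _); rewrite [LHS]mxE.
have E : [set y : 'rV[R]_d.+1 | (y *m a) 0 0 = b] =
         [set y | [set z | z 0 ord0 = b / s] (y *m col_ebase a)].
  apply/seteqP; split => y /=; rewrite Ey => h; first by rewrite -h mulrC mulKf.
  by rewrite h mulrC divfK.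
have mz : measurable_rV [set z : 'rV[R]_d.+1 | z 0 ord0 = b / s].
  have := measurable_rV_hyperplane (delta_mx ord0 0 : 'cV[R]_d.+1) (b / s).
  by congr measurable_rV; apply/seteqP; split => y /=; rewrite -colE mxE.
by rewrite E (lebesgue_rV_linear (col_ebase_unit a) mz) lebesgue_rV_hyperplane0 mule0.
Qed.

Lemma lebesgue_rV_mono d (A B : set 'rV[R]_d) :
  measurable_rV A -> measurable_rV B -> A `<=` B ->
  (lebesgue_rV A <= lebesgue_rV B)%E.
Proof.
move=> mA mB AB; apply: le_measure; rewrite ?inE//.
by move=> t /=; exact: AB.
Qed.

(** By induction on slices; this bound makes the measure of a polytope finite. *)
Lemma lebesgue_rV_box d (K : R) : 0 <= K ->
  (lebesgue_rV [set y : 'rV[R]_d | (forall i, `|y 0 i| <= K)%R] < +oo)%E.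
Proof.
move=> K0; elim: d => [|d IH].
  rewrite /lebesgue_rV /= /dirac indicE; exact: ltry.
rewrite lebesgue_rV_sections.
rewrite (_ : (fun x => _) =
  (fun x => lebesgue_rV [set y : 'rV[R]_d | forall i, `|y 0 i| <= K]) \_ `[- K, K]).
  rewrite -integral_mkcond integral_cst//= lte_mul_pinfty// ?lebesgue_rV_ge0//.
    by rewrite ge0_fin_numE ?lebesgue_rV_ge0.
  by rewrite lebesgue_measure_itv/=; case: ifPn => _; exact: ltry.
apply/funext => x; rewrite patchE; case: ifPn => xb.
  congr lebesgue_rV; apply/seteqP; split => y /= h i.
    by have := h (lift ord0 i); rewrite row_consS.
  case: (unliftP ord0 i) => [j|] ->; rewrite ?row_consS// row_cons0 ler_norml.
  by move: xb; rewrite inE/= in_itv.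
rewrite (_ : [set _ | _] = set0); first exact: measure0.
apply/seteqP; split => y//= /(_ ord0); rewrite row_cons0 ler_norml => h.
by case/negP: xb; rewrite inE/= in_itv.
Qed.

Lemma integral_exprn d : (\int[mu]_(s in `]0%R, 1%R]) (s ^+ d)%:E = (d.+1%:R^-1)%:E)%E.
Proof.
rewrite integral_itv_obnd_cbnd; last first.
  apply/measurable_EFinP; apply: measurable_funTS; exact: measurable_funX.
rewrite (@continuous_FTC2 R (fun s => s ^+ d) (fun s => s ^+ d.+1 / d.+1%:R))//.
- by rewrite expr1n expr0n mul0r sube0 div1r.
- by apply: continuous_in_subspaceT => x _; exact: exprn_continuous.
- split.
  + move=> x _; apply: derivableM; last exact: derivable_cst.
    exact: exprn_derivable.
  + apply: cvg_at_right_filter; apply: cvgM; last exact: cvg_cst.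
    exact: exprn_continuous.
  + apply: cvg_at_left_filter; apply: cvgM; last exact: cvg_cst.
    exact: exprn_continuous.
- move=> x _; rewrite derive1Mr; last exact: exprn_derivable.
  by rewrite exp_derive1 mulrC mulrA mulVf ?mul1r.
Qed.

(** The volume of a pyramid with apex at the origin and a translate of C as base
    at height h: the slice at x is that base scaled by x/h, and the integral of
    s^d over [0, 1] is 1/(d+1). *)
Lemma lebesgue_rV_cone d (S : set 'rV[R]_d.+1) (C : set 'rV[R]_d)
    (h : R) (p : 'rV[R]_d) :
  h != 0 -> measurable_rV S -> measurable_rV C ->
  (forall x y, x != 0 ->
     S (row_cons x y) <-> 0 < x / h <= 1 /\ C ((h / x) *: y + p)) ->
  lebesgue_rV S = ((`|h| / d.+1%:R)%:E * lebesgue_rV C)%E.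
Proof.
move=> h0 mS mC SE.
pose L (x : T) := lebesgue_rV [set y | S (row_cons x y)].
have mL : measurable_fun setT L by exact: measurable_lebesgue_section.
have L0 x : (0 <= L x)%E by exact: lebesgue_rV_ge0.
have hp : 0 < `|h| by rewrite normr_gt0.
have := ge0_integral_affine 0 h0 mL L0.
rewrite -lebesgue_rV_sections => E.
have -> : lebesgue_rV S = (`|h|%:E * \int[mu]_x L (h * x + 0)%R)%E.
  by rewrite E muleA -EFinM mulfV ?gt_eqF// mul1e.
rewrite EFinM -muleA; congr (_ * _)%E.
have mLh : measurable_fun setT (fun x : T => L (h * x + 0)%R).
  have mphi : measurable_fun [set: T] (fun x : T => h * x + 0 : T).
    by apply: measurable_funD => //; exact: measurable_funM.
  exact: (measurableT_comp mL mphi).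
rewrite -(@integral_setD1 _ _ 0 setT); last 2 first.
- exact: measurableD.
- exact: measurable_funTS mLh.
transitivity (\int[mu]_(s in `]0%R, 1%R]) ((s ^+ d)%:E * lebesgue_rV C))%E; last first.
  rewrite ge0_integralZr//.
  - by rewrite integral_exprn.
  - by apply/measurable_EFinP; apply: measurable_funTS; exact: measurable_funX.
  - by move=> x /=; rewrite in_itv/= => /andP[x0 _]; rewrite lee_fin exprn_ge0// ltW.
rewrite integral_mkcond [RHS]integral_mkcond; apply: eq_integral => s _.
rewrite !patchE; case: ifPn => [|/negP]; rewrite inE/= => s0; last first.
  case: ifPn => //; rewrite inE/= in_itv/= => /andP[sp _].
  by exfalso; apply: s0; split => // s00; move: sp; rewrite s00 ltxx.
have {}s0 : s != 0 by case: s0 => _ /eqP.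
have sh0 : h * s + 0 != 0 by rewrite addr0 mulf_neq0.
have hs : (h * s + 0) / h = s by rewrite addr0 mulrC mulKf.
case: ifPn => [|/negP]; rewrite inE/= in_itv/= => s1.
  have sp : 0 < s by case/andP: s1.
  have si : s^-1 != 0 by rewrite invr_eq0.
  have := lebesgue_rV_scale p si mC; rewrite normfV invrK gtr0_norm// => <-.
  congr lebesgue_rV; apply/seteqP; split => y /=; rewrite SE//;
  rewrite (_ : h / (h * s + 0) = s^-1) ?hs//;
  try by rewrite addr0 invfM mulrA mulfV// mul1r.
  by case.
rewrite /L (_ : [set _ | _] = set0); first exact: measure0.
by apply/seteqP; split => y//=; rewrite SE// hs => -[].
Qed.

Definition std_simplex d : set 'rV[R]_d :=
  [set y | (forall i, 0 <= y 0 i) /\ \sum_i y 0 i <= 1].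
Arguments std_simplex : clear implicits.

Lemma measurable_rV_simplex d : measurable_rV (std_simplex d).
Proof.
rewrite /measurable_rV.
have -> : [set t : d.-tuple T | std_simplex d (tuple_row t)] =
    (\bigcap_(i in [set: 'I_d]) [set t : d.-tuple T | 0 <= tnth t i]) `&`
    [set t : d.-tuple T | (tuple_row t *m (const_mx 1 : 'cV[R]_d)) 0 0 <= 1].
  apply/seteqP; split => t /=.
    move=> [h1 h2]; split; first by move=> i _ /=; have := h1 i; rewrite mxE.
    by rewrite mxE; under eq_bigr do rewrite [X in _ * X]mxE mulr1.
  move=> [h1 h2]; split; first by move=> i; have := h1 i I; rewrite /= mxE.
  by move: h2; rewrite mxE; under eq_bigr do rewrite [X in _ * X]mxE mulr1.
apply: measurableI; last exact: measurable_rV_halfspace.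
apply: fin_bigcap_measurable => [|i _]; first exact: finite_finset.
have := measurable_tnth i measurableT (measurable_itv `[(0 : R), +oo[).
by rewrite setTI; congr measurable; apply/seteqP; split => t /=; rewrite in_itv/= andbT.
Qed.

Lemma lebesgue_rV_simplex d : lebesgue_rV (std_simplex d) = (d`!%:R^-1)%:E.
Proof.
elim: d => [|d IH].
  rewrite /lebesgue_rV /= /dirac indicE mem_set ?invr1//=.
  by split; [case|rewrite big_ord0].
(* Translated by the first basis vector, the simplex is a pyramid with apex 0
   and height -1 over the simplex of dimension d. *)
rewrite -(lebesgue_rV_translate (row_cons 1 0) (@measurable_rV_simplex d.+1)).
rewrite (@lebesgue_rV_cone d _ (std_simplex d) (-1) 0).
- rewrite IH normrN1 div1r -EFinM factS natrM invfM//.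
- by rewrite oppr_eq0 oner_eq0.
- have := measurable_rV_affine 1%:M (row_cons 1 0) (@measurable_rV_simplex d.+1).
  by congr measurable_rV; apply/seteqP; split => y /=; rewrite mulmx1.
- exact: measurable_rV_simplex.
move=> x y x0; rewrite /= row_consD addr0 addr0 /std_simplex /= invrN1 mulrN1 mulN1r.
have -> : \sum_i row_cons (x + 1) y 0 i = x + 1 + \sum_i y 0 i.
  rewrite big_ord_recl row_cons0; congr (_ + _).
  by apply: eq_bigr => j _; rewrite row_consS.
have -> : \sum_i (- x^-1 *: y) 0 i = - x^-1 * \sum_i y 0 i.
  by rewrite mulr_sumr; apply: eq_bigr => j _; rewrite mxE.
split.
  move=> [h1 h2].
  have y0 j : 0 <= y 0 j by have := h1 (lift ord0 j); rewrite row_consS.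
  have x1 : 0 <= x + 1 by have := h1 ord0; rewrite row_cons0.
  have s0 : 0 <= \sum_j y 0 j by apply: sumr_ge0.
  have xn : 0 < - x by rewrite lt_neqAle eq_sym oppr_eq0 x0; lra.
  split; first by apply/andP; split => //; lra.
  rewrite -invrN; split; first by move=> i; rewrite mxE mulr_ge0// invr_ge0 ltW.
  by rewrite mulrC ler_pdivrMr//; lra.
move=> [/andP[xn x1]]; rewrite -invrN => -[h1 h2].
split; last by move: h2; rewrite mulrC ler_pdivrMr//; lra.
move=> i; case: (unliftP ord0 i) => [j|] ->; rewrite ?row_consS ?row_cons0; last by lra.
by have := h1 j; rewrite mxE pmulr_rge0// invr_gt0.
Qed.
End LebesgueRows.
Arguments std_simplex : clear implicits.

(** * Lattice points of rational subspaces *)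

Section IntegralRowSpaces.
Context {R : realType}.
Implicit Types n m d k r : nat.

(** Each invariant factor divides the next one, so the zeros come last. *)
Lemma invariant_factors_cut (d : seq int) (m : nat) : sorted dvdz d ->
  exists2 r, (r <= m)%N & forall i, (i < m)%N -> (d`_i != 0) = (i < r)%N.
Proof.
move=> sd; pose k := find (pred1 0) d; exists (minn k m); first exact: geq_minr.
move=> i im; rewrite leq_min im andbT.
have [ik|ki] := ltnP i k.
  by have /= -> := before_find 0 ik.
apply/negbTE; rewrite negbK.
have [si|ids] := leqP (size d) i; first by rewrite nth_default.
have kd : (k < size d)%N := leq_ltn_trans ki ids.
have := @sorted_leq_nth int dvdz dvdz_trans (fun x => dvdzz x) 0 d sd _ _ kd ids ki.
have /eqP -> := nth_find 0 (etrans (has_find _ _) kd).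
by rewrite -dvd0z.
Qed.

Lemma intmx_unit n (Q : 'M[int]_n) : Q \in unitmx -> intmx R Q \in unitmx.
Proof.
move=> uQ; have /(congr1 (intmx R)) := mulmxV uQ.
by rewrite map_mxM map_mx1 => /mulmx1_unit[].
Qed.

(** In the Smith form M = L D Q neither the invertible factor L nor the nonzero
    entries of the diagonal D change the real row space, which is therefore
    spanned by the first rows of the unimodular matrix Q. *)
Lemma smith_rowspace m n (M : 'M[int]_(m, n)) :
  exists r (Q : 'M[int]_n), [/\ (r <= n)%N, Q \in unitmx &
    (intmx R M :=: (pid_mx r : 'M[R]_(r, n)) *m intmx R Q)%MS].
Proof.
have [L uL [Q uQ [d sd ->]]] := int_Smith_normal_form M.
have [r rmn dr] := invariant_factors_cut (minn m n) sd.
have rm : (r <= m)%N := leq_trans rmn (geq_minl _ _).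
have rn : (r <= n)%N := leq_trans rmn (geq_minr _ _).
exists r, Q; split => //.
set D := \matrix_(i, j) _.
have uLR := intmx_unit uL.
rewrite !map_mxM -mulmxA.
apply: eqmx_trans (eqmxMfull _ _) _; first by rewrite row_full_unit.
apply: eqmxMr.
apply/eqmxP/andP; split; apply/row_subP => i.
  have [ir|ri] := ltnP i r; last first.
    rewrite (_ : row i _ = 0) ?sub0mx//; apply/rowP => j; rewrite !mxE.
    case: eqP => [ij|_]; last by rewrite mulr0n.
    have imn : (i < minn m n)%N by rewrite leq_min ltn_ord /= ij ltn_ord.
    have := dr i imn.
    by rewrite ltnNge ri /= => /negbFE/eqP->; rewrite mul0rn.
  rewrite (_ : row i _ = (d`_i)%:~R *: row (Ordinal ir) (pid_mx r)).
    exact/scalemx_sub/row_sub.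
  apply/rowP => j; rewrite !mxE ir andbT.
  by case: eqP => _; rewrite ?mulr1n ?mulr0n ?mulr1 ?mulr0.
pose i' := widen_ord rm i.
have di : (d`_i)%:~R != 0 :> R.
  rewrite intr_eq0 dr//; exact: leq_trans (ltn_ord i) rmn.
rewrite (_ : row i _ = (d`_i)%:~R^-1 *: row i' (intmx R D)).
  exact/scalemx_sub/row_sub.
apply/rowP => j; rewrite !mxE ltn_ord andbT.
by case: eqP => _; rewrite ?mulr1n ?mulr0n ?mulr0// mulVf.
Qed.

(** Over the integers a right inverse means more than independent rows: no further
    lattice point lies in their real span, see [saturated_Zbasis]. *)
Definition saturated d n (U : 'M[int]_(d, n)) := exists V, U *m V = 1%:M.

Lemma saturated_first_rows r n (Q : 'M[int]_n) : (r <= n)%N -> Q \in unitmx ->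
  saturated ((pid_mx r : 'M[int]_(r, n)) *m Q).
Proof.
move=> rn uQ; exists (invmx Q *m pid_mx r).
by rewrite mulmxA mulmxK// pid_mx_id// pid_mx_1.
Qed.

Lemma intmx_inj m n : injective (intmx R : 'M[int]_(m, n) -> 'M[R]_(m, n)).
Proof.
move=> A B /matrixP AB; apply/matrixP => i j.
by have := AB i j; rewrite !mxE => /intr_inj.
Qed.

Lemma saturated_right_inverse d n (U : 'M[int]_(d, n)) : saturated U ->
  exists2 V : 'M[int]_(n, d), U *m V = 1%:M & intmx R U *m intmx R V = 1%:M.
Proof. by move=> [V UV]; exists V => //; rewrite -map_mxM UV map_mx1. Qed.

Lemma saturated_row_free d n (U : 'M[int]_(d, n)) : saturated U -> row_free (intmx R U).
Proof.
by move=> /saturated_right_inverse[V _ UV]; apply/row_freeP; exists (intmx R V).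
Qed.

Definition rowset d n (A : 'M[R]_(d, n)) : set 'rV[R]_n :=
  [set t *m A | t in [set: 'rV_d]].

Lemma rowsetP d n (A : 'M[R]_(d, n)) x : rowset A x <-> (x <= A)%MS.
Proof.
split; first by move=> [t _ <-]; exact: submxMl.
by move=> /submxP[t ->]; exists t.
Qed.

(** If x = t U is integral and U V = 1, then t = x V is integral as well. *)
Lemma saturated_Zbasis d n (U : 'M[int]_(d, n)) : saturated U ->
  Zbasis (lattice_points (rowset (intmx R U))) U.
Proof.
move=> /saturated_right_inverse[V UV UVR]; split.
- by move=> c _; rewrite /lattice_points/= map_mxM; exists (intmx R c).
- by move=> c c' _ _ /(congr1 (mulmx^~ V)); rewrite -!mulmxA UV !mulmx1.
- move=> z [t _ tz]; exists (z *m V) => //; apply: intmx_inj.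
  by rewrite !map_mxM -tz -[t *m _ *m _]mulmxA UVR mulmx1.
Qed.

(** Two bases express each other by integer matrices, which are inverse to each
    other because coordinates are unique. *)
Lemma Zbasis_unimodular d n (U U' : 'M[int]_(d, n)) : saturated U ->
  Zbasis (lattice_points (rowset (intmx R U))) U' ->
  exists2 C, C \in unitmx & U' = C *m U.
Proof.
move=> sU bU'.
have [hU iU sjU] := saturated_Zbasis sU.
have [hU' iU' sjU'] := bU'.
have ex (W W' : 'M[int]_(d, n)) :
   set_surj [set: 'rV[int]_d] (lattice_points (rowset (intmx R U))) (fun c => c *m W) ->
   (forall c, lattice_points (rowset (intmx R U)) (c *m W')) -> exists C, W' = C *m W.
  move=> sj h.
  have /choice[C hC] : forall i, exists c : 'rV[int]_d, c *m W = row i W'.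
    by move=> i; have [c _ /= E] := sj _ (h (delta_mx 0 i)); exists c; rewrite rowE E.
  exists (\matrix_i C i); apply/row_matrixP => i.
  by rewrite row_mul rowK hC.
have [C EC] := ex _ _ sjU (fun c => hU' c I).
have [C' EC'] := ex _ _ sjU' (fun c => hU c I).
exists C => //.
have CC' : C *m C' = 1%:M.
  apply/row_matrixP => i; apply: (iU' _ _ (in_setT _) (in_setT _)) => /=.
  by rewrite -!row_mul -mulmxA -EC' -EC mul1mx.
by have [] := mulmx1_unit CC'.
Qed.

Lemma saturated_unimodular d n (U : 'M[int]_(d, n)) C : saturated U -> C \in unitmx ->
  saturated (C *m U).
Proof.
move=> [V UV] uC; exists (V *m invmx C).
by rewrite mulmxA -(mulmxA C) UV mulmx1 mulmxV.
Qed.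

Lemma rat_common_denominator m n (A : 'M[rat]_(m, n)) :
  exists2 N : int, N != 0 & exists M : 'M[int]_(m, n), map_mx intr M = N%:~R *: A.
Proof.
pose N := \prod_(ij : 'I_m * 'I_n) denq (A ij.1 ij.2).
exists N; first by apply/prodf_neq0 => ij _; exact: denq_neq0.
exists (\matrix_(i, j)
  ((\prod_(ij : 'I_m * 'I_n | ij != (i, j)) denq (A ij.1 ij.2)) * numq (A i j))).
apply/matrixP => i j; rewrite !mxE /N [in RHS](bigD1 (i, j))//= !intrM numqE.
by rewrite [A i j * _]mulrC mulrA; congr (_ * _); exact: mulrC.
Qed.

(** Clearing denominators does not change the row space, so that Smith's normal
    form applies. *)
Lemma rational_rowspace m n (A : 'M[rat]_(m, n)) :
  exists r (U : 'M[int]_(r, n)), saturated U /\ (map_mx ratr A :=: intmx R U)%MS.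
Proof.
have [N N0 [M EM]] := rat_common_denominator A.
have [r [Q [rn uQ EQ]]] := smith_rowspace M.
exists r, ((pid_mx r : 'M[int]_(r, n)) *m Q); split; first exact: saturated_first_rows.
rewrite map_mxM map_pid_mx; apply: eqmx_trans EQ.
have -> : intmx R M = N%:~R *: map_mx ratr A.
  apply/matrixP => i j; rewrite !mxE.
  have /matrixP/(_ i j) := EM; rewrite !mxE => /(congr1 (ratr : rat -> R)).
  by rewrite rmorphM /= !ratr_int.
by apply/eqmx_sym/eqmx_scale; rewrite intr_eq0.
Qed.

End IntegralRowSpaces.

(** * Linear forms and primitive forms *)

Section LinearForms.
Context {R : realType} {n : nat}.

(** Linear forms are represented by columns, so that sums, multiples and
    restrictions to row spaces are matrix expressions; by [scalar_lform] every
    linear form arises in this way. *)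
Definition lform (a : 'cV[R]_n) (x : 'rV[R]_n) : R := (x *m a) 0 0.

Lemma lform_is_linear a : linear_for *%R (lform a).
Proof. by move=> c x y; rewrite /lform mulmxDl -scalemxAl !mxE. Qed.

HB.instance Definition _ a := GRing.isLinear.Build R 'rV[R]_n R *%R (lform a)
  (lform_is_linear a).

Lemma scalar_lform (f : {scalar 'rV[R]_n}) : exists a, forall x, f x = lform a x.
Proof.
exists (\col_i f (delta_mx 0 i)) => x.
rewrite {1}(row_sum_delta x) linear_sum /lform mxE; apply: eq_bigr => i _.
by rewrite linearZ mxE.
Qed.

Lemma lformD a x y : lform a (x + y) = lform a x + lform a y.
Proof. by rewrite linearD. Qed.
Lemma lformB a x y : lform a (x - y) = lform a x - lform a y.
Proof. by rewrite linearB. Qed.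
Lemma lformZ a c x : lform a (c *: x) = c * lform a x.
Proof. by rewrite linearZ. Qed.

End LinearForms.

Section PrimitiveForms.
Context {R : realType}.

Lemma sub_pid_last k (u : 'rV[R]_k.+1) :
  (u <= (pid_mx k : 'M[R]_(k, k.+1)))%MS <-> u 0 ord_max = 0.
Proof.
split.
  move=> /submxP[s ->]; rewrite mxE big1// => j _.
  by rewrite mxE /= ltn_eqF ?ltn_ord// mulr0.
move=> u0; apply/submxP; exists (u *m (pid_mx k : 'M[R]_(k.+1, k))).
rewrite -mulmxA pid_mx_id//; apply/rowP => i; rewrite mxE.
rewrite (bigD1 i)//= big1 ?addr0; last first.
  by move=> j ji; rewrite mxE (inj_eq val_inj) (negbTE ji) mulr0.
rewrite mxE eqxx /=; case: ltnP => [_|ki]; first by rewrite mulr1.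
rewrite mulr0 (_ : i = ord_max) ?u0//; apply: val_inj => /=.
by apply/eqP; rewrite eqn_leq ki -ltnS ltn_ord.
Qed.

(** In the coordinates given by U the rows of W span a saturated sublattice of
    corank one, that is the span of the first k rows of a unimodular matrix Q.
    The wanted form reads off the last coordinate with respect to Q. *)
Lemma primitive_form_hyperplane k n (U : 'M[int]_(k.+1, n)) (W : 'M[int]_(k, n)) :
  saturated U -> row_free (intmx R W) -> (intmx R W <= intmx R U)%MS ->
  exists f : {scalar 'rV[R]_n},
    primitive_form (lattice_points (rowset (intmx R U))) f /\
    forall x, rowset (intmx R U) x -> (rowset (intmx R W) x <-> f x = 0).
Proof.
move=> sU fW WU.
have [V UV UVR] := saturated_right_inverse (R := R) sU.
pose N := W *m V.
have NU : N *m U = W.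
  apply: (@intmx_inj R); rewrite !map_mxM; have /submxP[t ->] := WU.
  by rewrite -!mulmxA (mulmxA (intmx R U)) UVR mul1mx.
have [r [Q [rk uQ EQ]]] := smith_rowspace (R := R) N.
have fN : \rank (intmx R N) = k.
  apply/eqP; rewrite eqn_leq rank_leq_row /=.
  move: fW; rewrite /row_free -NU map_mxM => /eqP fW.
  by have := mxrankM_maxl (intmx R N) (intmx R U); rewrite fW.
have uQR := intmx_unit (R := R) uQ.
have rE : r = k.
  apply/esym; move: fN; rewrite EQ mxrankMfree ?row_free_unit//.
  by rewrite rank_pid_mx.
subst r.
pose c : 'cV[int]_n := V *m invmx Q *m delta_mx ord_max 0.
pose f := lform (intmx R c).
have fE t : f (t *m intmx R U) = (t *m intmx R (invmx Q)) 0 ord_max.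
  rewrite /f /lform /c !map_mxM !mulmxA -(mulmxA t) UVR mulmx1.
  by rewrite map_delta_mx -colE mxE.
have QQ : intmx R Q *m intmx R (invmx Q) = 1%:M by rewrite -map_mxM mulmxV// map_mx1.
have QQ' : intmx R (invmx Q) *m intmx R Q = 1%:M by rewrite -map_mxM mulVmx// map_mx1.
exists f; split.
  split.
    by move=> z _; rewrite /f /= /lform -map_mxM mxE; exact: intr_int.
  exists (delta_mx 0 ord_max *m Q *m U).
    by exists (intmx R (delta_mx 0 ord_max *m Q)) => //; rewrite !map_mxM.
  rewrite [intmx R (delta_mx 0 ord_max *m Q *m U)]map_mxM; apply: (etrans (fE _)).
  by rewrite map_mxM -mulmxA QQ mulmx1 map_delta_mx mxE !eqxx.
move=> _ [t _ <-]; rewrite [X in _ <-> X = _](fE t) -sub_pid_last rowsetP.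
rewrite -NU map_mxM submxMfree ?saturated_row_free// EQ.
by rewrite -[X in (X <= _)%MS]mulmx1 -QQ' mulmxA submxMfree// row_free_unit.
Qed.

End PrimitiveForms.

(** * Finitely generated cones are polyhedral *)

Section FiniteCones.
Context {R : realType}.

(** Minkowski-Weyl by Fourier-Motzkin elimination. A point x belongs to the cone
    with one more generator q0 when x - t q0 belongs to the old cone for some
    t >= 0; this bounds t below by a(x)/a(q0) for the forms with a(q0) > 0 and
    above for those with a(q0) < 0, and a solution t exists precisely when every
    lower bound is at most every upper bound. *)
Lemma cone_halfspaces n m (q : 'I_m -> 'rV[R]_n) :
  exists s : seq 'cV[R]_n, forall x,
    (exists2 c : 'I_m -> R, (forall i, 0 <= c i) & x = \sum_i c i *: q i) <->
    (forall a, a \in s -> lform a x <= 0).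
Proof.
elim: m q => [|m IH] q.
  exists ([seq delta_mx j 0 | j <- enum 'I_n] ++ [seq - delta_mx j 0 | j <- enum 'I_n]).
  move=> x; split.
    by move=> [c _ ->] a _; rewrite big_ord0 /lform mul0mx mxE.
  move=> h; exists (fun _ => 0) => //; rewrite big_ord0.
  apply/rowP => j; rewrite [RHS]mxE.
  apply/le_anti/andP; split.
    have := h (delta_mx j 0); rewrite /lform -colE mxE; apply.
    by rewrite mem_cat; apply/orP; left; apply/mapP; exists j; rewrite ?mem_enum.
  have := h (- delta_mx j 0); rewrite /lform mulmxN -colE mxE oppr_le0 mxE; apply.
  by rewrite mem_cat; apply/orP; right; apply/mapP; exists j; rewrite ?mem_enum.
have [s sP] := IH (fun i => q (lift ord0 i)).
pose q0 := q ord0.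
pose pos (a : 'cV[R]_n) := 0 < lform a q0.
pose neg (a : 'cV[R]_n) := lform a q0 < 0.
exists ([seq a <- s | ~~ pos a] ++
  [seq lform a q0 *: b - lform b q0 *: a |
    a <- [seq a <- s | pos a], b <- [seq b <- s | neg b]]).
have lfE a b x : lform (lform a q0 *: b - lform b q0 *: a) x =
    lform a q0 * lform b x - lform b q0 * lform a x.
  by rewrite /lform mulmxBr -!scalemxAr !mxE.
move=> x; split.
  move=> [c c0 ->]; rewrite big_ord_recl -/q0.
  set y := \sum_(i < m) _.
  have hy : forall a, a \in s -> lform a y <= 0.
    by apply/sP; exists (fun i => c (lift ord0 i)).
  move=> a; rewrite mem_cat => /orP[|/allpairsP[[a1 b1] /= [ ]]].
    rewrite mem_filter /pos -leNgt => /andP[ap /hy ay].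
    by rewrite lformD lformZ; have := mulr_ge0_le0 (c0 ord0) ap; move: (ay); lra.
  rewrite !mem_filter /pos /neg => /andP[a1p /hy a1s] /andP[b1n /hy b1s] ->.
  rewrite lfE !lformD !lformZ.
  have p1 : lform a1 q0 * lform b1 y <= 0 by rewrite mulr_ge0_le0// ltW.
  have p2 : 0 <= lform b1 q0 * lform a1 y by rewrite mulr_le0// ltW.
  by rewrite !mulrDr [lform b1 q0 * (_ * _)]mulrCA [lform a1 q0 * (_ * _)]mulrCA
    [lform b1 q0 * lform a1 q0]mulrC opprD addrACA subrr add0r subr_le0 (le_trans p1).
move=> h.
(* The largest of all lower bounds on t. *)
pose t := \big[Num.max/0]_(a <- s | pos a) (lform a x / lform a q0).
have t0 : 0 <= t by exact: bigmax_ge_id.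
have /sP[c c0 cE] : forall a, a \in s -> lform a (x - t *: q0) <= 0.
  move=> a sa; rewrite lformB lformZ.
  have [ap|an|a0] := ltgtP 0 (lform a q0).
  - rewrite subr_le0 -ler_pdivrMr//.
    by rewrite /t; apply: (@le_bigmax_seq _ _ _ _ _ a).
  - rewrite subr_le0 -ler_ndivlMr// /t big_seq_cond; apply: bigmax_le.
      rewrite ler_ndivlMr// mul0r; apply: h.
      by rewrite mem_cat mem_filter /pos -leNgt (ltW an) sa.
    move=> b /andP[sb bp]; rewrite ler_ndivlMr// mulrAC ler_pdivlMr//.
    have := h (lform b q0 *: a - lform a q0 *: b).
    rewrite lfE subr_le0 mulrC [lform a q0 * _]mulrC; apply.
    rewrite mem_cat; apply/orP; right; apply/allpairsP; exists (b, a) => /=.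
    by split; rewrite ?mem_filter ?sb ?sa ?andbT.
  - rewrite -a0 mulr0 subr0; apply: h.
    by rewrite mem_cat mem_filter /pos -a0 ltxx sa.
exists (fun i => if unlift ord0 i is Some j then c j else t).
  by move=> i; case: unliftP => [j|] _.
rewrite big_ord_recl unlift_none -/q0.
under eq_bigr do rewrite liftK.
by rewrite -cE addrC subrK.
Qed.

End FiniteCones.

(** * Polytopes as intersections of half-spaces *)

Section ConvexHulls.
Context {R : realType} {n : nat}.
Implicit Types (x y v : 'rV[R]_n) (X P F : set 'rV[R]_n).

Lemma lform_sum (a : 'cV[R]_n) k (c : 'I_k -> R) (p : 'I_k -> 'rV[R]_n) :
  lform a (\sum_i c i *: p i) = \sum_i c i * lform a (p i).
Proof. by rewrite linear_sum; apply: eq_bigr => i _; rewrite linearZ. Qed.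

Lemma conv_hull_le X (a : 'cV[R]_n) b :
  (forall x, X x -> lform a x <= b) -> forall x, conv_hull X x -> lform a x <= b.
Proof.
move=> h x [k [p [c [Xp c0 c1 ->]]]]; rewrite lform_sum -[b]mul1r -c1 mulr_suml.
by apply: ler_sum => i _; rewrite ler_wpM2l// h.
Qed.

Lemma conv_hull_self X : X `<=` conv_hull X.
Proof.
move=> x Xx; exists 1%N, (fun _ => x), (fun _ => 1).
by split => //; rewrite big_ord1 ?scale1r.
Qed.

Lemma aff_hull_self X : X `<=` aff_hull X.
Proof.
move=> x Xx; exists 1%N, (fun _ => x), (fun _ => 1).
by split => //; rewrite big_ord1 ?scale1r.
Qed.

Lemma aff_hull_eq X (a : 'cV[R]_n) b :
  (forall x, X x -> lform a x = b) -> forall x, aff_hull X x -> lform a x = b.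
Proof.
move=> h x [k [p [c [Xp c1 ->]]]]; rewrite lform_sum -[b]mul1r -c1 mulr_suml.
by apply: eq_bigr => i _; rewrite h.
Qed.

Lemma aff_hull_sub X Y : X `<=` Y -> aff_hull X `<=` aff_hull Y.
Proof.
by move=> XY x [k [p [c [Xp c1 ->]]]]; exists k, p, c; split => // i; exact/XY.
Qed.

(** Homogenization: x is a convex combination of the q i exactly when (x, 1) lies
    in the cone generated by the (q i, 1). *)
Lemma conv_halfspaces m (q : 'I_m -> 'rV[R]_n) :
  exists s : seq ('cV[R]_n * R), forall x,
    conv_hull (range q) x <-> (forall ab, ab \in s -> lform ab.1 x <= ab.2).
Proof.
pose up x : 'rV[R]_(n + 1) := row_mx x 1%:M.
have [s sP] := cone_halfspaces (fun i => up (q i)).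
have lformup (a : 'cV[R]_(n + 1)) x : lform a (up x) = lform (usubmx a) x + dsubmx a 0 0.
  by rewrite /lform -{1}(vsubmxK a) mul_row_col mxE mul1mx.
exists [seq (usubmx a, - dsubmx a 0 0) | a <- s] => x; split.
  move=> cx _ /mapP[a sa ->] /=; apply: conv_hull_le cx => _ [i _ <-].
  suff : lform a (up (q i)) <= 0 by rewrite lformup; lra.
  apply: (proj1 (sP _)) a sa; exists (fun j => (j == i)%:R) => //.
  rewrite (bigD1 i)//= eqxx scale1r big1 ?addr0// => j ji.
  by rewrite (negbTE ji) scale0r.
move=> h; have /sP[c c0 cE] : forall a, a \in s -> lform a (up x) <= 0.
  move=> a sa; rewrite lformup; suff : lform (usubmx a) x <= - dsubmx a 0 0 by lra.
  by have := h (usubmx a, - dsubmx a 0 0); apply; apply/mapP; exists a.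
exists m, q, c; split => //.
- have := congr1 (fun M : 'rV_(n + 1) => rsubmx M 0 0) cE.
  rewrite row_mxKr mxE eqxx mulr1n => E; apply: etrans (esym E).
  rewrite linear_sum summxE; apply: eq_bigr => i _.
  by rewrite linearZ /= row_mxKr !mxE eqxx mulr1.
- have := congr1 (fun M : 'rV_(n + 1) => lsubmx M) cE.
  rewrite row_mxKl => ->.
  rewrite linear_sum; apply: eq_bigr => i _.
  by rewrite linearZ /= row_mxKl.
Qed.

Lemma conv_hull_range_sub m (q : 'I_m -> 'rV[R]_n) X :
  X `<=` conv_hull (range q) -> conv_hull X `<=` conv_hull (range q).
Proof.
have [s sP] := conv_halfspaces q => h x cx; apply/sP => ab sab.
by apply: conv_hull_le cx => y /h/sP; exact.
Qed.

Lemma conv_hull_rangeP m (q : 'I_m -> 'rV[R]_n) x : conv_hull (range q) x ->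
  exists c : 'I_m -> R, [/\ forall i, 0 <= c i, \sum_i c i = 1 & x = \sum_i c i *: q i].
Proof.
move=> [k [p [c [Xp c0 c1 ->]]]].
have /choice[g gE] : forall j, exists i, q i = p j.
  by move=> j; have [i _] := Xp j; exists i.
exists (fun i => \sum_(j | g j == i) c j); split.
- by move=> i; exact: sumr_ge0.
- by rewrite -c1 (partition_big g xpredT).
- rewrite (partition_big g xpredT)//=; apply: eq_bigr => i _.
  by rewrite scaler_suml; apply: eq_bigr => j /eqP <-; rewrite gE.
Qed.

(** A half-space that contains the other generators but not q i supports the
    polytope at q i alone. *)
Lemma vertex_separated m (q : 'I_m.+1 -> 'rV[R]_n) i :
  ~ conv_hull (range (fun j => q (lift i j))) (q i) ->
  vertex (conv_hull (range q)) (q i).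
Proof.
have [s sP] := conv_halfspaces (fun j => q (lift i j)) => /sP.
move=> /existsNP[[a b]] /not_implyP[sab] /=; move/negP; rewrite -ltNge => bi.
have hj j : lform a (q (lift i j)) < lform a (q i).
  apply: le_lt_trans bi.
  by have /sP := conv_hull_self (imageT (fun j => q (lift i j)) j) => /(_ _ sab).
have hle j : lform a (q j) <= lform a (q i).
  by case: (unliftP i j) => [k|] ->; rewrite ?lexx// ltW.
exists (lform a), (lform a (q i)); split.
  by apply: conv_hull_le => _ [j _ <-].
apply/seteqP; split => x /=.
  by move=> ->; split => //; apply: conv_hull_self; exact: imageT.
move=> [/conv_hull_rangeP[c [c0 c1 ->]]] /eqP; rewrite lform_sum.
rewrite -[X in _ == X]mul1r -c1 mulr_suml -subr_eq0 -sumrB -oppr_eq0 -sumrN.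
under eq_bigr do rewrite opprB -mulrBr.
rewrite psumr_eq0; last by move=> j _; rewrite mulr_ge0// subr_ge0.
move=> /allP h.
have cz j : j != i -> c j = 0.
  move=> ji; have /eqP/esym := h j (mem_index_enum j) => /eqP.
  rewrite /= eq_sym mulf_eq0 subr_eq0 => /orP[/eqP//|/eqP].
  have [k ->] : exists k, j = lift i k.
    by case: (unliftP i j) ji => [k|] ->; [exists k|rewrite eqxx].
  by move=> E; have := hj k; rewrite E ltxx.
have ci : c i = 1 by rewrite -c1 (bigD1 i)//= big1 ?addr0.
rewrite (bigD1 i)//= big1 ?addr0 ?ci ?scale1r// => j ji.
by rewrite cz// scale0r.
Qed.

(** In a generating family of minimal size no member is redundant, so all of them
    are vertices, and vertices are rational by assumption. *)
Lemma rational_generators P : rational_polytope P ->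
  exists m (q : 'I_m -> 'rV[rat]_n),
    P = conv_hull (range (fun i => map_mx ratr (q i) : 'rV[R]_n)).
Proof.
move=> [[m0 [p0 Pp0]] vP].
pose gen m := `[< exists p : 'I_m -> 'rV[R]_n, P = conv_hull (range p) >].
have ex : exists m, gen m by exists m0; apply/asboolP; exists p0.
case: (ex_minnP ex) => m /asboolP[p Pp] mmin.
have vp i : vertex P (p i).
  case: m i p Pp mmin => [[]//|m] i p Pp mmin.
  rewrite {1}Pp; apply: vertex_separated => ci.
  suff : (m.+1 <= m)%N by rewrite ltnn.
  apply: mmin; apply/asboolP; exists (fun j => p (lift i j)).
  rewrite Pp; apply/seteqP; split.
    apply: conv_hull_range_sub => _ [j _ <-].
    case: (unliftP i j) => [k|] -> //; apply: conv_hull_self.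
    by exists k.
  apply: conv_hull_range_sub => _ [j _ <-]; apply: conv_hull_self.
  by exists (lift i j).
have /choice[q qE] : forall i, exists q : 'rV[rat]_n, p i = map_mx ratr q.
  by move=> i; exact/vP/vp.
exists m, q; rewrite Pp (_ : p = fun i => map_mx ratr (q i))//.
by apply/funext => i.
Qed.

Definition subfam (T : Type) m (q : 'I_m -> T) (I : {set 'I_m}) (k : 'I_#|I|) : T :=
  q (enum_val k).
Arguments subfam {T m} q I k.

(** An average of values bounded by b equals b only if all values of positive
    weight do; thus a face is generated by the generators it contains. *)
Lemma face_conv m (q : 'I_m -> 'rV[R]_n) (a : 'cV[R]_n) b (I : {set 'I_m}) :
  (forall i, lform a (q i) <= b) -> (forall i, i \in I <-> lform a (q i) = b) ->
  conv_hull (range q) `&` [set x | lform a x = b] = conv_hull (range (subfam q I)).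
Proof.
move=> hb hI; apply/seteqP; split => x; last first.
  move=> cx; split.
    apply: conv_hull_range_sub cx => _ [j _ <-]; apply: conv_hull_self.
    by exists (enum_val j).
  case: cx => k [p [c [Xp c0 c1 ->]]] /=; rewrite lform_sum -[RHS]mul1r -c1 mulr_suml.
  apply: eq_bigr => j _; have [l _ <-] := Xp j.
  by congr (_ * _); apply/hI; exact: enum_valP.
move=> [/conv_hull_rangeP[c [c0 c1 xE]] /= xb].
have cz j : j \notin I -> c j = 0.
  move=> jI; move/eqP: xb; rewrite xE lform_sum.
  rewrite -[X in _ == X]mul1r -c1 mulr_suml -subr_eq0 -sumrB -oppr_eq0 -sumrN.
  under eq_bigr do rewrite opprB -mulrBr.
  rewrite psumr_eq0; last by move=> i _; rewrite mulr_ge0// subr_ge0.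
  move=> /allP /(_ j (mem_index_enum j)) /=.
  rewrite mulf_eq0 subr_eq0 => /orP[/eqP//|/eqP E].
  by case/negP: jI; apply/hI.
exists #|I|, (subfam q I), (fun k => c (enum_val k)); split => //.
  rewrite -c1 (bigID [in I])/= [X in _ + X]big1 ?addr0; last by move=> j /cz.
  by rewrite [RHS]big_enum_val.
rewrite xE (bigID [in I])/= [X in _ + X]big1 ?addr0; last first.
  by move=> j /cz ->; rewrite scale0r.
by rewrite big_enum_val.
Qed.
End ConvexHulls.
Arguments subfam {T m} q I k.

(** * Faces and facets *)

Section Facets.
Context {R : realType} {n m : nat}.
Variable q : 'I_m -> 'rV[R]_n.
Local Notation P := (conv_hull (range q)).
Implicit Types (x y v : 'rV[R]_n) (F G : set 'rV[R]_n).

Lemma lform_delta (c : R) j (z : 'rV[R]_n) : lform (c *: delta_mx j 0) z = c * z 0 j.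
Proof. by rewrite /lform -scalemxAr mxE -colE; congr (_ * _); rewrite mxE. Qed.

Lemma gen_in i : P (q i).
Proof. exact/conv_hull_self/imageT. Qed.

Lemma faceP F : face P F <-> exists (a : 'cV[R]_n) b,
  (forall x, P x -> lform a x <= b) /\ F = P `&` [set x | lform a x = b].
Proof.
split=> [[f [b [fb ->]]]|[a [b [ab ->]]]]; last by exists (lform a), b.
have [a fa] := scalar_lform f; exists a, b; split; first by move=> x /fb; rewrite fa.
by apply/seteqP; split => x /=; rewrite fa.
Qed.

Definition gens F : {set 'I_m} := [set i | `[< F (q i) >]]%SET.

Lemma gensP F i : i \in gens F <-> F (q i).
Proof. by rewrite inE; split => /asboolP. Qed.

Lemma face_gens F : face P F -> F = conv_hull (range (subfam q (gens F))).
Proof.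
move=> /faceP[a [b [ab FE]]]; rewrite {1}FE; apply: face_conv => i.
  exact/ab/gen_in.
by rewrite gensP FE; split => [[]|]//; split => //; exact: gen_in.
Qed.

Lemma finite_faces : finite_set (face P).
Proof.
apply: (@sub_finite_set _ _
  ((fun I => conv_hull (range (subfam q I))) @` [set: {set 'I_m}])).
  by move=> F fF; exists (gens F) => //; rewrite -face_gens.
exact/finite_image/finite_finset.
Qed.

Lemma finite_facets : finite_set (facets P).
Proof. by apply: sub_finite_set finite_faces => F [[]]. Qed.

(** A strictly larger face contains strictly more of the generators, so ascending
    chains of proper faces stop. *)
Lemma proper_face_in_facet G : proper_face P G -> exists2 F, facets P F & G `<=` F.
Proof.
have [k] := ubnP (m - #|gens G|); elim: k G => // k IH G ltk pG.
have [|/existsNP[G']] := pselect (forall G', proper_face P G' -> G `<=` G' -> G' = G).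
  by move=> mG; exists G.
move=> /not_implyP[pG' /not_implyP[GG' G'G]].
have gsub : gens G \proper gens G'.
  rewrite finset.properEneq; apply/andP; split.
    by apply/eqP => E; apply: G'G; rewrite (face_gens pG.1) (face_gens pG'.1) E.
    by apply/fintype.subsetP => i; move/gensP => h; apply/gensP; exact: GG'.
have [|F fF G'F] := IH G' _ pG'; last by exists F => //; exact: subset_trans G'F.
have := proper_card gsub; have := max_card (gens G').
by move: ltk; rewrite card_ord; lia.
Qed.

Lemma conv_bounded (a : 'cV[R]_n) x : P x -> lform a x <= \sum_i `|lform a (q i)|.
Proof.
apply: conv_hull_le => _ [i _ <-]; rewrite (bigD1 i)//= (le_trans (ler_norm _))//.
by rewrite lerDl sumr_ge0.
Qed.

(** Follow the ray from v through x to the last point y of the polytope. It exists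
    as the polytope is bounded; there one of the finitely many inequalities
    becomes tight, and it is strict at v because it increases along the ray. *)
Lemma exit_face v x : P v -> P x -> x <> v ->
  exists (a : 'cV[R]_n) b y s, [/\ forall z, P z -> lform a z <= b,
    P y, lform a y = b /\ lform a v < b, 0 < s <= 1 & x = v + s *: (y - v)].
Proof.
move=> Pv Px xv; have [hs hsP] := conv_halfspaces q.
pose u := x - v.
pose ab i := nth (0, 0) hs i.
pose pos (i : 'I_(size hs)) := 0 < lform (ab i).1 u.
(* The parameter at which the ray meets the i-th bounding hyperplane. *)
pose rat (i : 'I_(size hs)) := ((ab i).2 - lform (ab i).1 v) / lform (ab i).1 u.
have abhs (i : 'I_(size hs)) : ab i \in hs by exact: mem_nth.
have [i0 pi0] : exists i, pos i.
  apply: contrapT => /forallNP nopos.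
  have ray t : 0 <= t -> P (v + t *: u).
    move=> t0; apply/hsP => c chs; rewrite lformD lformZ.
    have vc : lform c.1 v <= c.2 by move/hsP: Pv; exact.
    suff : t * lform c.1 u <= 0 by move: vc; lra.
    rewrite mulr_ge0_le0// leNgt; apply/negP => cu.
    have ic : (index c hs < size hs)%N by rewrite index_mem.
    by apply: (nopos (Ordinal ic)); rewrite /pos /ab /= nth_index.
  have [j uj] : exists j, u 0 j != 0.
    apply: contrapT => /forallNP u0; apply: xv; apply/eqP.
    rewrite -subr_eq0; apply/eqP/rowP => j.
    by rewrite [RHS]mxE; apply/eqP/negPn/negP; exact: u0.
  pose a : 'cV[R]_n := u 0 j *: delta_mx j 0.
  have au : 0 < lform a u.
    by rewrite lform_delta -expr2 exprn_even_gt0//= uj.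
  pose K := \sum_i `|lform a (q i)| - lform a v.
  have := conv_bounded a (ray ((`|K| + 1) / lform a u) _).
  rewrite lformD lformZ divfK ?gt_eqF// => h.
  have t0 : 0 <= (`|K| + 1) / lform a u by rewrite divr_ge0// ltW.
  have := h t0; have := ler_norm K; rewrite /K; lra.
case: (@arg_minP _ _ _ i0 pos rat pi0) => i pi imin.
set a := (ab i).1; set b := (ab i).2.
have au : 0 < lform a u := pi.
have s1 : 1 <= rat i.
  rewrite /rat ler_pdivlMr// mul1r -/a -/b /u lformB lerB//.
  by move/hsP: Px => /(_ _ (abhs i)).
have s0 : 0 < rat i by exact: lt_le_trans s1.
pose y := v + rat i *: u.
exists a, b, y, (rat i)^-1; split.
- by move=> z /hsP/(_ _ (abhs i)).
- apply/hsP => c chs; rewrite lformD lformZ.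
  have vc : lform c.1 v <= c.2 by move/hsP: Pv; exact.
  have [cu|cu] := leP (lform c.1 u) 0.
    by have := mulr_ge0_le0 (ltW s0) cu; move: vc; lra.
  have ic : (index c hs < size hs)%N by rewrite index_mem.
  have := imin (Ordinal ic); rewrite /pos /rat /ab /= nth_index// => /(_ cu).
  by rewrite -/(rat i) ler_pdivlMr// lerBrDl.
- have E : rat i * lform a u = b - lform a v by rewrite /rat divfK// gt_eqF.
  split; first by rewrite lformD lformZ E; lra.
  by rewrite -subr_gt0 -E mulr_gt0.
- by rewrite invr_gt0 s0 invf_le1.
- have -> : y - v = rat i *: u by rewrite /y addrAC subrr add0r.
  by rewrite scalerA mulVf ?gt_eqF// scale1r addrC subrK.
Qed.

End Facets.

(** * Facets span hyperplanes *)

Section AffConv.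
Context {R : realType} {n : nat}.
Implicit Types (x y v : 'rV[R]_n).

Lemma rowspace_separation d (A : 'M[R]_(d, n)) z : ~~ (z <= A)%MS ->
  exists g : 'cV[R]_n, lform g z != 0 /\ forall i, lform g (row i A) = 0.
Proof.
rewrite submxE => h.
have [j zj] : exists j, (z *m cokermx A) 0 j != 0.
  apply: contrapT => /forallNP h'; case/negP: h; apply/eqP/rowP => j.
  by rewrite [RHS]mxE; apply/eqP/negPn/negP; exact: h'.
have gE y : lform (cokermx A *m delta_mx j 0) y = (y *m cokermx A) 0 j.
  by rewrite /lform mulmxA -colE [LHS]mxE.
exists (cokermx A *m delta_mx j 0); split; first by rewrite gE.
by move=> i; rewrite gE -row_mul mulmx_coker row0 mxE.
Qed.

Lemma conv_sub_aff (X : set 'rV[R]_n) : conv_hull X `<=` aff_hull X.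
Proof. by move=> x [k [p [c [Xp c0 c1 ->]]]]; exists k, p, c. Qed.

Lemma aff_conv_eq m (q : 'I_m -> 'rV[R]_n) (g : 'cV[R]_n) b :
  (forall i, lform g (q i) = b) ->
  forall x, aff_hull (conv_hull (range q)) x -> lform g x = b.
Proof.
move=> h; apply: aff_hull_eq => x /conv_sub_aff; apply: aff_hull_eq => _ [i _ <-] //.
Qed.

(** Every point outside the right-hand side is detected by a linear form which is
    constant on the generators. *)
Lemma aff_conv_rowspace m (q : 'I_m -> 'rV[R]_n) i0 x :
  aff_hull (conv_hull (range q)) x <-> (x - q i0 <= \matrix_i (q i - q i0))%MS.
Proof.
split=> [ax|/submxP[t xt]].
  apply/negPn/negP => /rowspace_separation[g [gz grow]].
  have gq i : lform g (q i) = lform g (q i0).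
    by apply/eqP; rewrite -subr_eq0 -lformB; have := grow i; rewrite rowK => ->.
  by move: gz; rewrite lformB (aff_conv_eq gq ax) subrr eqxx.
exists m, q, (fun i => t 0 i + (i == i0)%:R * (1 - \sum_j t 0 j)); split.
- by move=> i; exact: gen_in.
- have E : \sum_i (i == i0)%:R = 1 :> R.
    by rewrite (bigD1 i0)//= eqxx big1 ?addr0// => i /negbTE ->.
  by rewrite big_split /= -mulr_suml E mul1r addrC subrK.
- rewrite -(subrK (q i0) x) xt mulmx_sum_row.
  under eq_bigr do rewrite rowK.
  under [RHS]eq_bigr do rewrite scalerDl.
  have E : \sum_i ((i == i0)%:R * (1 - \sum_j t 0 j)) *: q i = (1 - \sum_j t 0 j) *: q i0.
    move: (1 - _) => s; rewrite (bigD1 i0)//= eqxx mul1r big1 ?addr0// => i /negbTE ->.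
    by rewrite mul0r scale0r.
  rewrite big_split /= E; under eq_bigr do rewrite scalerBr.
  by rewrite sumrB -scaler_suml scalerBl scale1r -addrA [- _ + _]addrC.
Qed.

End AffConv.

Section FacetHyperplane.
Context {R : realType} {n m : nat}.
Variable q : 'I_m -> 'rV[R]_n.
Local Notation P := (conv_hull (range q)).
Implicit Types (x y v : 'rV[R]_n) (F G : set 'rV[R]_n).

(** A supporting hyperplane a = b of F that contains a point x of the affine hull
    of P outside that of F can be tilted: take a linear form g that is constant on
    F but not on F and x together, and move from a towards a + t g until the next
    generator is touched. The new supporting hyperplane cuts out a proper face
    strictly larger than F, so F was not maximal. *)
Lemma facet_hyperplane F : facets P F -> F !=set0 ->
  exists (a : 'cV[R]_n) b,
  [/\ forall x, P x -> lform a x <= b, F = P `&` [set x | lform a x = b],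
      exists2 x, P x & lform a x < b
    & forall x, aff_hull P x -> (aff_hull F x <-> lform a x = b)].
Proof.
move=> [[fF FP] Fmax] [x0 Fx0].
have [a [b [ab FE]]] := (faceP q F).1 fF.
exists a, b; split => //.
  apply: contrapT => h; apply: FP; rewrite FE; apply/seteqP; split => x; first by case.
  move=> Px; split => //=; apply/eqP; rewrite eq_le ab//= leNgt; apply/negP => xb.
  by apply: h; exists x.
have FC := face_gens fF.
have [j0 j0I] : exists j, j \in gens q F.
  move: Fx0; rewrite {1}FC => -[k [p [c [Xp c0 c1 _]]]].
  case: k p c Xp c0 c1 => [|k] p c Xp c0 c1.
    by move: c1; rewrite big_ord0 => /eqP; rewrite eq_sym oner_eq0.
  by have [j _ _] := Xp ord0; exists (enum_val j); exact: (enum_valP j).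
have aF i : i \in gens q F <-> lform a (q i) = b.
  by rewrite gensP FE; split => [[]|]//; split => //; exact: gen_in.
move=> x Ax; split.
  by apply: aff_hull_eq => y; rewrite FE => -[].
move=> xb; apply: contrapT; rewrite FC => nF.
pose k0 := enum_rank_in j0I j0.
have qk0 : subfam q (gens q F) k0 = q j0 by rewrite /subfam enum_rankK_in.
have : ~~ (x - q j0 <= \matrix_k (subfam q (gens q F) k - q j0))%MS.
  by apply/negP; rewrite -qk0 => /(aff_conv_rowspace _ k0 x)/nF.
move=> /rowspace_separation[g0 [g0z g0row]].
have g0F i : i \in gens q F -> lform g0 (q i) = lform g0 (q j0).
  move=> iI; apply/eqP; rewrite -subr_eq0 -lformB.
  have := g0row (enum_rank_in iI i); rewrite rowK /subfam enum_rankK_in// => ->.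
  exact: eqxx.
(* Up to sign, g0 exceeds its value on F at some generator. *)
have [g [gz gF [j1 gj1]]] : exists g : 'cV[R]_n, [/\ lform g (x - q j0) != 0,
    forall i, i \in gens q F -> lform g (q i) = lform g (q j0) &
    exists j, lform g (q j0) < lform g (q j)].
  have [j hj] : exists j, lform g0 (q j) != lform g0 (q j0).
    apply: contrapT => /forallNP h.
    have h' j : lform g0 (q j) = lform g0 (q j0) by apply/eqP/negPn/negP; exact: h.
    by move: g0z; rewrite lformB (aff_conv_eq h' Ax) subrr eqxx.
  have gN y : lform (- g0) y = - lform g0 y by rewrite /lform mulmxN mxE.
  have [lt|ge] := ltP (lform g0 (q j0)) (lform g0 (q j)).
    by exists g0; split => //; exists j.
  exists (- g0); split.
  - by rewrite gN oppr_eq0.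
  - by move=> i /g0F; rewrite !gN => ->.
  - by exists j; rewrite !gN ltrN2 lt_neqAle hj.
pose pos j := lform g (q j0) < lform g (q j).
(* The tilted form a + t g reaches its bound at the generator j when t = rat j. *)
pose slack j := b - lform a (q j).
pose rat j := slack j / (lform g (q j) - lform g (q j0)).
case: (@arg_minP _ _ _ j1 pos rat gj1) => j pj jmin.
have jI : j \notin gens q F.
  by apply/negP => /gF E; move: pj; rewrite /pos E ltxx.
have dj : 0 < lform g (q j) - lform g (q j0) by rewrite subr_gt0.
have sj : 0 < slack j.
  rewrite /slack subr_gt0 lt_neqAle ab ?andbT; last exact: gen_in.
  by apply: contra jI => /eqP ?; apply/aF.
pose t := rat j.
have t0 : 0 < t by rewrite /t /rat divr_gt0.
pose a' := a + t *: g; pose b' := b + t * lform g (q j0).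
have a'E y : lform a' y = lform a y + t * lform g y.
  by rewrite /lform mulmxDr -scalemxAr !mxE.
pose F' := P `&` [set y | lform a' y = b'].
have fF' : face P F'.
  apply/faceP; exists a', b'; split => //; apply: conv_hull_le => _ [i _ <-].
  rewrite a'E /b' -lerBrDl.
  suff : t * (lform g (q i) - lform g (q j0)) <= slack i by rewrite /slack; lra.
  have [gi|gi] := ltP (lform g (q j0)) (lform g (q i)).
    by rewrite -ler_pdivlMr ?subr_gt0//; exact: jmin.
  apply: (@le_trans _ _ 0); last by rewrite /slack subr_ge0; apply/ab/gen_in.
  by rewrite mulr_ge0_le0 ?subr_le0// ltW.
have F'P : F' <> P.
  move=> E; have h i : lform a' (q i) = b'.
    by have := gen_in q i; rewrite -{1}E => -[].
  have := aff_conv_eq h Ax; rewrite a'E /b' xb => /addrI/(mulfI (lt0r_neq0 t0)) E'.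
  by move: gz; rewrite lformB E' subrr eqxx.
have FF' : F `<=` F'.
  rewrite FC; apply: (subset_trans (conv_hull_range_sub (q := subfam q (gens q F')) _)).
    move=> _ [k _ <-].
    have kI := enum_valP k.
    have kI' : enum_val k \in gens q F'.
      apply/gensP; split; first exact: gen_in.
      by rewrite /= a'E (aF _).1// gF.
    by exists 1%N, (fun _ => subfam q (gens q F) k), (fun _ => 1); split => //;
      rewrite ?big_ord1 ?scale1r// => _; exists (enum_rank_in kI' (enum_val k)) => //;
      rewrite /subfam enum_rankK_in.
  by rewrite -face_gens.
have F'F := Fmax F' (conj fF' F'P) FF'.
case/negP: jI; apply/gensP; rewrite -F'F; split; first exact: gen_in.
rewrite /= a'E /b'; have : t * (lform g (q j) - lform g (q j0)) = slack j.
  by rewrite /t /rat divfK// gt_eqF.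
by rewrite /slack; lra.
Qed.

End FacetHyperplane.

(** * Pyramids over the facets *)

Section Cones.
Context {R : realType} {n : nat}.
Implicit Types (x y v : 'rV[R]_n) (F G : set 'rV[R]_n).

Definition cone v F : set 'rV[R]_n :=
  [set x | exists s y, [/\ 0 <= s <= 1, F y & x = v + s *: (y - v)]].

Lemma lform_comb (c d : R) (a b : 'cV[R]_n) x :
  lform (c *: a - d *: b) x = c * lform a x - d * lform b x.
Proof. by rewrite /lform mulmxBr -!scalemxAr !mxE. Qed.

Lemma lform_segment (a : 'cV[R]_n) v y s :
  lform a (v + s *: (y - v)) = lform a v + s * (lform a y - lform a v).
Proof. by rewrite lformD lformZ lformB. Qed.

Lemma conv_segment m (q : 'I_m -> 'rV[R]_n) v y s : 0 <= s <= 1 ->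
  conv_hull (range q) v -> conv_hull (range q) y ->
  conv_hull (range q) (v + s *: (y - v)).
Proof.
have [hs hsP] := conv_halfspaces q => /andP[s0 s1] /hsP Pv /hsP Py.
apply/hsP => ab sab; rewrite lform_segment.
have := Pv _ sab; have := Py _ sab => h1 h2.
rewrite (_ : _ + _ = (1 - s) * lform ab.1 v + s * lform ab.1 y); last by ring.
rewrite (_ : ab.2 = (1 - s) * ab.2 + s * ab.2); last by ring.
by rewrite lerD// ler_wpM2l// subr_ge0.
Qed.

Definition apex_cons m v (p : 'I_m -> 'rV[R]_n) (i : 'I_m.+1) : 'rV[R]_n :=
  if unlift ord0 i is Some j then p j else v.

Lemma cone_conv m v (p : 'I_m.+1 -> 'rV[R]_n) :
  cone v (conv_hull (range p)) = conv_hull (range (apex_cons v p)).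
Proof.
have cv : conv_hull (range (apex_cons v p)) v.
  by apply: conv_hull_self; exists ord0 => //; rewrite /apex_cons unlift_none.
have cp j : conv_hull (range (apex_cons v p)) (p j).
  by apply: conv_hull_self; exists (lift ord0 j) => //; rewrite /apex_cons liftK.
apply/seteqP; split => x.
  move=> [s [y [s01 cy ->]]]; apply: conv_segment => //.
  by apply: conv_hull_range_sub cy => _ [j _ <-].
move=> /conv_hull_rangeP[c [c0 c1 ->]]; move: c1; rewrite big_ord_recl.
set s := \sum_(i < _) c _ => c1.
have -> : \sum_i c i *: apex_cons v p i = c ord0 *: v + \sum_j c (lift ord0 j) *: p j.
  rewrite big_ord_recl /apex_cons unlift_none; congr (_ + _).
  by apply: eq_bigr => j _; rewrite liftK.
have s0 : 0 <= s by exact: sumr_ge0.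
have cE : c ord0 = 1 - s by rewrite -c1 addrK.
have s1 : s <= 1 by rewrite -subr_ge0 -cE.
have [sz|snz] := eqVneq s 0.
  exists 0, (p ord0); split; rewrite ?lexx ?ler01//; first exact: gen_in.
  rewrite scale0r addr0 cE sz subr0 scale1r big1 ?addr0// => j _.
  have /eqP := sz; rewrite psumr_eq0; last by move=> i _; exact: c0.
  by move=> /allP/(_ j (mem_index_enum j))/eqP ->; rewrite scale0r.
exists s, (\sum_j (c (lift ord0 j) / s) *: p j); split; first by rewrite s0.
  exists m.+1, p, (fun j => c (lift ord0 j) / s); split => //.
  - by move=> j; rewrite divr_ge0.
  - by rewrite -mulr_suml mulfV.
have -> : s *: (\sum_j (c (lift ord0 j) / s) *: p j - v) =
    \sum_j c (lift ord0 j) *: p j - s *: v.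
  rewrite scalerBr scaler_sumr; congr (_ - _).
  by apply: eq_bigr => j _; rewrite scalerA mulrC divfK.
by rewrite cE scalerBl scale1r addrA addrAC.
Qed.
End Cones.

Section Cover.
Context {R : realType} {n m : nat}.
Variable q : 'I_m -> 'rV[R]_n.
Local Notation P := (conv_hull (range q)).
Implicit Types (x y v : 'rV[R]_n) (F G : set 'rV[R]_n).

Lemma facet_sub F : facets P F -> F `<=` P.
Proof. by move=> [[/faceP[a [b [_ ->]]] _] _] x []. Qed.

Lemma facet_exit v x : P v -> P x -> x <> v ->
  exists F, [/\ facets P F, F !=set0 & cone v F x].
Proof.
move=> Pv Px xv.
have [a [b [y [s [ab Py [yb vb] /andP[s0 s1] xE]]]]] := exit_face Pv Px xv.
pose G := P `&` [set x | lform a x = b].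
have pG : proper_face P G.
  split; first by apply/faceP; exists a, b.
  by move=> E; move: Pv; rewrite -E => -[_ /= E']; move: vb; rewrite E' ltxx.
have [F fF GF] := proper_face_in_facet pG.
have Fy : F y by apply: GF.
exists F; split => //; first by exists y.
by exists s, y; split => //; rewrite (ltW s0) s1.
Qed.

Lemma facet_nonempty v x F : P v -> P x -> x <> v -> facets P F -> F !=set0.
Proof.
move=> Pv Px xv fF; apply: contrapT => /nonemptyPn F0.
have [F1 [fF1 [y F1y] _]] := facet_exit Pv Px xv.
by have := fF.2 _ fF1.1; rewrite F0 => /(_ (@sub0set _ _)) E; rewrite E in F1y; case: F1y.
Qed.

Lemma cone_sub_polytope v F : P v -> facets P F -> cone v F `<=` P.
Proof.
by move=> Pv /facet_sub FP _ [s [y [s01 /FP Py ->]]]; exact: conv_segment.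
Qed.

(** A point x of P other than v lies on the segment from v to the point where the
    ray through x leaves P, and this point lies in some facet. *)
Lemma facet_cones_cover v x0 : P v -> P x0 -> x0 <> v ->
  P = \bigcup_(F in facets P) cone v F.
Proof.
move=> Pv Px0 x0v; apply/seteqP; split => x; last first.
  by move=> [F fF]; exact: cone_sub_polytope.
move=> Px; have [->|/eqP xv] := eqVneq x v.
  have [F [fF [y Fy] _]] := facet_exit Pv Px0 x0v.
  by exists F => //; exists 0, y; split; rewrite ?lexx ?ler01// scale0r addr0.
by have [F [fF _ cF]] := facet_exit Pv Px xv; exists F.
Qed.

(** On a common point x = v + s (y - v) = v + s' (y' - v) of two pyramids the forms
    of F and F', normalized to be 0 at v and 1 on the facet, take the values s and
    s'. These agree, since neither form exceeds 1 on P. The difference of the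
    normalized forms thus vanishes on the overlap, and if it vanished on the whole
    affine hull, then F and F' would coincide. *)
Lemma facet_cones_overlap v F F' : P v -> facets P F -> facets P F' ->
  F !=set0 -> F' !=set0 -> F <> F' -> ~ aff_hull F v -> ~ aff_hull F' v ->
  exists g : 'cV[R]_n, (exists2 x, aff_hull P x & lform g x <> lform g v) /\
    cone v F `&` cone v F' `<=` [set x | lform g x = lform g v].
Proof.
move=> Pv fF fF' F0 F'0 FF' nF nF'.
have [a [b [ab FE _ aE]]] := facet_hyperplane fF F0.
have [a' [b' [ab' FE' _ aE']]] := facet_hyperplane fF' F'0.
have Av : aff_hull P v by exact: aff_hull_self.
have vb : 0 < b - lform a v.
  by rewrite subr_gt0 lt_neqAle ab// andbT; apply/eqP => E; apply: nF; exact/(aE v Av).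
have vb' : 0 < b' - lform a' v.
  by rewrite subr_gt0 lt_neqAle ab'// andbT; apply/eqP => E; apply: nF'; exact/(aE' v Av).
pose g := (b' - lform a' v) *: a - (b - lform a v) *: a'.
have gE x : lform g x = (b' - lform a' v) * lform a x - (b - lform a v) * lform a' x.
  exact: lform_comb.
exists g; split.
  apply: contrapT => h; apply: FF'.
  have gc x : aff_hull P x -> lform g x = lform g v.
    by move=> Ax; apply: contrapT => hx; apply: h; exists x.
  have key x : aff_hull P x -> (b' - lform a' v) * (lform a x - lform a v) =
      (b - lform a v) * (lform a' x - lform a' v).
    by move=> /gc; rewrite !gE; lra.
  rewrite FE FE'; apply/seteqP; split => x [Px /= xb]; split => //=.
    have := key x (aff_hull_self Px); rewrite xb mulrC => /(mulfI (lt0r_neq0 vb)); lra.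
  have := key x (aff_hull_self Px); rewrite xb [RHS]mulrC => /(mulfI (lt0r_neq0 vb')); lra.
move=> x [[s [y [/andP[s0 s1] Fy xE]]] [s' [y' [/andP[s'0 s'1] Fy' xE']]]] /=.
have [Py ya] : P y /\ lform a y = b by move: Fy; rewrite FE.
have [Py' ya'] : P y' /\ lform a' y' = b' by move: Fy'; rewrite FE'.
have e1 : lform a x - lform a v = s * (b - lform a v).
  by rewrite xE lform_segment ya; ring.
have e2 : lform a x - lform a v = s' * (lform a y' - lform a v).
  by rewrite xE' lform_segment; ring.
have e3 : lform a' x - lform a' v = s' * (b' - lform a' v).
  by rewrite xE' lform_segment ya'; ring.
have e4 : lform a' x - lform a' v = s * (lform a' y - lform a' v).
  by rewrite xE lform_segment; ring.
have ss' : s <= s'.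
  rewrite -(ler_pM2r vb) -e1 e2 ler_wpM2l//; have := ab _ Py'; lra.
have s's : s' <= s.
  rewrite -(ler_pM2r vb') -e3 e4 ler_wpM2l//; have := ab' _ Py; lra.
have E : s = s' by apply/le_anti; rewrite ss' s's.
rewrite !gE; have -> : lform a x = lform a v + s * (b - lform a v) by rewrite -e1; ring.
have -> : lform a' x = lform a' v + s * (b' - lform a' v) by rewrite E -e3; ring.
by ring.
Qed.

(** The supporting form of F takes at v the value that it has on F, hence is
    constant on the pyramid. *)
Lemma cone_in_hyperplane v F : facets P F -> F !=set0 -> P v -> aff_hull F v ->
  exists (g : 'cV[R]_n), (exists2 x, aff_hull P x & lform g x <> lform g v) /\
    cone v F `<=` [set x | lform g x = lform g v].
Proof.
move=> fF F0 Pv Fv; have [a [b [ab FE [x Px xb] aE]]] := facet_hyperplane fF F0.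
have vb : lform a v = b by apply/aE => //; exact: aff_hull_self.
exists a; split.
  exists x; first exact: aff_hull_self.
  by rewrite vb => E; move: xb; rewrite E ltxx.
move=> _ [s [y [_ Fy ->]]] /=; rewrite lform_segment.
have -> : lform a y = b by move: Fy; rewrite FE => -[].
by rewrite vb subrr mulr0 addr0.
Qed.
End Cover.

(** * Lattice coordinates on an affine subspace *)

Section Charts.
Context {R : realType} {n : nat}.
Implicit Types (x y v w : 'rV[R]_n) (A X F : set 'rV[R]_n).

Definition chart d (U : 'M[int]_(d, n)) w X : set 'rV[R]_d :=
  [set t | X (w + t *m intmx R U)].

(** The rows of U are a lattice basis of the linear space directing A. *)
Definition lattice_chart A d (U : 'M[int]_(d, n)) :=
  saturated U /\ forall w, A w -> forall x, A x <-> rowset (intmx R U) (x - w).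

Lemma rowset_linear d (B : 'M[R]_(d, n)) x y c :
  rowset B x -> rowset B y -> rowset B (x + c *: y).
Proof.
by move=> /rowsetP hx /rowsetP hy; apply/rowsetP; rewrite addmx_sub// scalemx_sub.
Qed.

Lemma rowsetB d (B : 'M[R]_(d, n)) x y : rowset B x -> rowset B y -> rowset B (x - y).
Proof. by move=> hx /(rowset_linear (-1) hx); rewrite scaleN1r. Qed.

Lemma polytope_lattice_chart m (q : 'I_m -> 'rV[rat]_n) (i0 : 'I_m) :
  exists d (U : 'M[int]_(d, n)),
    lattice_chart
      (aff_hull (conv_hull (range (fun i => map_mx ratr (q i) : 'rV[R]_n)))) U.
Proof.
have [d [U [sU EU]]] := rational_rowspace (R := R) (\matrix_i (q i - q i0)).
exists d, U; split => //.
set qR := fun i => _.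
have E : map_mx ratr (\matrix_i (q i - q i0)) = \matrix_i (qR i - qR i0).
  by apply/matrixP => i j; rewrite !mxE rmorphB.
have Ax x : aff_hull (conv_hull (range qR)) x <-> rowset (intmx R U) (x - qR i0).
  by rewrite (aff_conv_rowspace qR i0) -E EU rowsetP.
move=> w /Ax Aw x; rewrite Ax; split => h.
  by have := rowsetB h Aw; rewrite opprB addrA subrK.
by have := rowset_linear 1 h Aw; rewrite scale1r addrA subrK.
Qed.

Lemma recenter_chart A d (U : 'M[int]_(d, n)) w : lattice_chart A U -> A w ->
  recenter A w = rowset (intmx R U).
Proof.
move=> [_ cA] Aw; apply/seteqP; split => x.
  by move=> [y Ay <-]; apply/cA.
by move=> Ux; exists (x + w); [apply/(cA w) => //|]; rewrite addrK.
Qed.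

Lemma base_point_in A : A !=set0 -> A (base_point A).
Proof.
move=> [x Ax]; rewrite /base_point; case: pselect => [//|A0].
exact: (@xgetPex _ 0 A (ex_intro _ x Ax)).
Qed.

Lemma aff_dim_chart X d (U : 'M[int]_(d, n)) : X !=set0 ->
  lattice_chart (aff_hull X) U -> aff_dim X = d.
Proof.
move=> [w Xw] [sU cU].
have Aw : aff_hull X w by exact: aff_hull_self.
pose f : 'Hom('rV[R]_d, 'rV[R]_n) := linfun (mulmxr (intmx R U)).
pose V := limg f.
have VE x : (x \in V) <-> rowset (intmx R U) x.
  split; first by move=> /memv_imgP[t _ ->]; exists t => //; rewrite lfunE.
  move=> [t _ <-]; apply/memv_imgP; exists t; first exact: memvf.
  by rewrite lfunE.
have dV : \dim V = d.
  have /eqP K : lker f == 0%VS.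
    by apply/lker0P => t t'; rewrite !lfunE /=; exact/row_free_inj/saturated_row_free.
  by rewrite /V limg_dim_eq ?K ?capv0// dimvf dim_matrix; exact: mul1n.
have AE : aff_hull X = [set w + y | y in [set` V]].
  apply/seteqP; split => x.
    by move=> /(cU w Aw)/VE h; exists (x - w) => //; rewrite addrC subrK.
  by move=> [y /VE Vy <-]; apply/(cU w Aw); rewrite addrC addKr.
rewrite /aff_dim; apply: xget_unique; first by exists w, V.
move=> d' [w' [V' [AE' <-]]]; rewrite -dV.
have [y0 V'y0 wE] : [set w' + y | y in [set` V']] w by rewrite -AE'.
congr (\dim _); apply/vspaceP => x; apply/idP/idP => Vx.
  have : aff_hull X (w' + (y0 + x)) by rewrite AE'; exists (y0 + x) => //; exact: memvD.
  rewrite addrA wE AE => -[y Vy /addrI <-] //.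
have : aff_hull X (w + x) by rewrite AE; exists x.
rewrite AE' -wE -addrA => -[y V'y /addrI yE].
by rewrite -(addKr y0 x) -yE addrC memvB.
Qed.

Lemma unimodular_norm_det d (C : 'M[int]_d) : C \in unitmx -> `|\det (intmx R C)| = 1.
Proof.
rewrite unitmxE det_map_mx => uC.
have : `|\det C| = 1.
  have : (\det C == 1) || (\det C == -1) := uC.
  by case/orP => /eqP ->.
by rewrite -intr_norm => ->.
Qed.

(** Another origin and another lattice basis amount to a translation and a
    unimodular transformation of the coordinates. *)
Lemma chart_change d (U : 'M[int]_(d, n)) C w w' X : C \in unitmx ->
  rowset (intmx R U) (w' - w) -> measurable_rV (chart U w X) ->
  measurable_rV (chart (C *m U) w' X) /\
  lebesgue_rV (chart (C *m U) w' X) = lebesgue_rV (chart U w X).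
Proof.
move=> uC [t0 _ Et0] mX.
have -> : chart (C *m U) w' X = [set t | chart U w X (t *m intmx R C + t0)].
  apply/seteqP; split => t; rewrite /chart /= map_mxM mulmxDl Et0 mulmxA;
  by rewrite addrCA [w + _]addrC subrK [w' + _]addrC.
have mX' := measurable_rV_affine 1%:M t0 mX; rewrite /= in mX'.
have {}mX' : measurable_rV [set t | chart U w X (t + t0)].
  by move: mX'; congr measurable_rV; apply/seteqP; split => t /=; rewrite mulmx1.
split; first exact: measurable_rV_affine.
have := lebesgue_rV_linear (intmx_unit (R := R) uC) mX'.
rewrite unimodular_norm_det// invr1 mul1e => ->.
exact: lebesgue_rV_translate.
Qed.

Lemma measurable_rV_chart_conv d (U : 'M[int]_(d, n)) w m (q : 'I_m -> 'rV[R]_n) :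
  measurable_rV (chart U w (conv_hull (range q))).
Proof.
have [s sP] := conv_halfspaces q.
have -> : chart U w (conv_hull (range q)) =
    [set t | forall ab, ab \in s -> lform ab.1 (w + t *m intmx R U) <= ab.2].
  by apply/seteqP; split => t /sP.
elim: s {sP} => [|ab s IH].
  rewrite (_ : [set t | _] = setT); first exact: measurableT.
  by apply/seteqP.
have -> :
   [set t | forall c, c \in ab :: s -> lform c.1 (w + t *m intmx R U) <= c.2] =
   [set t | (t *m (intmx R U *m ab.1)) 0 0 <= ab.2 - lform ab.1 w] `&`
   [set t | forall ab, ab \in s -> lform ab.1 (w + t *m intmx R U) <= ab.2].
  have E t : lform ab.1 (w + t *m intmx R U) =
      lform ab.1 w + (t *m (intmx R U *m ab.1)) 0 0.
    by rewrite lformD; congr (_ + _); rewrite /lform mulmxA.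
  apply/seteqP; split => t /=.
    move=> h; split; last by move=> c cs; apply: h; rewrite inE cs orbT.
    by rewrite lerBrDl -E; apply: h; rewrite inE eqxx.
  move=> [h1 h2] c; rewrite inE => /orP[/eqP ->|]; last exact: h2.
  by rewrite E -lerBrDl.
exact: measurableI (measurable_rV_halfspace _ _) IH.
Qed.

(** The coordinates are affine functions, hence bounded on a polytope. *)
Lemma lebesgue_rV_chart_lty d (U : 'M[int]_(d, n)) w m (q : 'I_m -> 'rV[R]_n) :
  saturated U ->
  (lebesgue_rV (chart U w (conv_hull (range q))) < +oo)%E.
Proof.
move=> /(saturated_right_inverse (R := R))[V _ UV].
pose a i := col i (intmx R V).
pose B i := \sum_j `|lform (a i) (q j)| + \sum_j `|lform (- a i) (q j)| +
  `|lform (a i) w|.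
have B0 i : 0 <= B i by rewrite !addr_ge0// sumr_ge0.
pose K := \sum_i B i.
have K0 : 0 <= K by exact: sumr_ge0.
apply: le_lt_trans (lebesgue_rV_box d K0).
apply: lebesgue_rV_mono; first exact: measurable_rV_chart_conv.
  rewrite /measurable_rV (_ : [set t | _] = \bigcap_(i in [set: 'I_d])
     ([set t | tuple_row t 0 i <= K] `&` [set t | - K <= tuple_row t 0 i])).
    apply: fin_bigcap_measurable => [|i _]; first exact: finite_finset.
    have E (c : R) (t : d.-tuple (measurableTypeR R)) :
        (tuple_row t *m (c *: delta_mx i 0)) 0 0 = c * tuple_row t 0 i :=
      lform_delta c i (tuple_row t).
    apply: measurableI.
      have := measurable_rV_halfspace (1 *: delta_mx i 0 : 'cV[R]_d) K.
      congr measurable; apply/seteqP; split => t /=;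
      by rewrite E mul1r.
    have := measurable_rV_halfspace (-1 *: delta_mx i 0 : 'cV[R]_d) K.
    congr measurable; apply/seteqP; split => t /=;
    by rewrite E mulN1r lerNl.
  apply/seteqP; split => t /=.
    by move=> h i _; have := h i; rewrite ler_norml => /andP[].
  by move=> h i; rewrite ler_norml; apply/andP; have [] := h i I.
move=> t Pt i.
have -> : t 0 i = lform (a i) (w + t *m intmx R U) - lform (a i) w.
  rewrite lformD addrC addKr /lform /a colE !mulmxA -(mulmxA t) UV mulmx1 -colE.
  by rewrite mxE.
have h1 := conv_bounded (a i) Pt.
have h2 := conv_bounded (- a i) Pt.
have h3 := ler_norm (lform (a i) w).
have h4 := ler_norm (- lform (a i) w).
have s1 : 0 <= \sum_j `|lform (a i) (q j)| by exact: sumr_ge0.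
have s2 : 0 <= \sum_j `|lform (- a i) (q j)| by exact: sumr_ge0.
have EN : lform (- a i) (w + t *m intmx R U) = - lform (a i) (w + t *m intmx R U).
  by rewrite /lform mulmxN mxE.
rewrite normrN in h4; rewrite EN in h2.
apply: (@le_trans _ _ (B i)).
  by rewrite ler_norml /B; apply/andP; split; lra.
by rewrite /K (bigD1 i)//= lerDl sumr_ge0.
Qed.

End Charts.

(** * Lattice volume in coordinates *)

Section Volume.
Context {R : realType} {n : nat}.
Implicit Types (x y v w : 'rV[R]_n) (A X F : set 'rV[R]_n).

Lemma unit_simplex_coords d (U : 'M[int]_(d, n)) (t : 'rV[R]_d) : saturated U ->
  unit_simplex U (t *m intmx R U) <-> std_simplex R d t.
Proof.
move=> /(saturated_right_inverse (R := R))[V _ UV].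
have rowE i : map_mx intr (row i U) = row i (intmx R U) by rewrite map_row.
split.
  move=> [k [p [c [Xp c0 c1 E]]]].
  have coord j : (forall i, 0 <= (p j *m intmx R V) 0 i) /\
      \sum_i (p j *m intmx R V) 0 i <= 1.
    have [->|[l _ <-]] := Xp j.
      rewrite mul0mx; split=> [i|]; first by rewrite mxE.
      by rewrite big1 ?ler01// => l _; rewrite mxE.
    rewrite rowE -row_mul UV; split; first by move=> i; rewrite !mxE ler0n.
    rewrite (bigD1 l)//= big1; first by rewrite !mxE eqxx addr0.
    by move=> o ol; rewrite !mxE eq_sym (negbTE ol).
  have tE i : t 0 i = \sum_j c j * (p j *m intmx R V) 0 i.
    have := congr1 (fun x => (x *m intmx R V) 0 i) E.
    rewrite -mulmxA UV mulmx1 => ->.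
    rewrite mulmx_suml summxE; apply: eq_bigr => j _.
    by rewrite -scalemxAl mxE.
  split.
    move=> i; rewrite tE; apply: sumr_ge0 => j _.
    by rewrite mulr_ge0//; have [] := coord j.
  under eq_bigr do rewrite tE.
  rewrite exchange_big /= -[leRHS]c1; apply: ler_sum => j _.
  rewrite -mulr_sumr -[leRHS]mulr1 ler_wpM2l//.
  by have [] := coord j.
move=> [t0 t1].
pose p (i : 'I_d.+1) : 'rV[R]_n :=
  if unlift ord0 i is Some j then map_mx intr (row j U) else 0.
pose c (i : 'I_d.+1) : R :=
  if unlift ord0 i is Some j then t 0 j else 1 - \sum_j t 0 j.
exists d.+1, p, c; split.
- by move=> i; rewrite /p; case: unliftP => [j|] _; [right; exists j|left].
- by move=> i; rewrite /c; case: unliftP => [j|] _ //; rewrite subr_ge0.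
- rewrite big_ord_recl {1}/c unlift_none.
  have -> : \sum_(i < d) c (lift ord0 i) = \sum_i t 0 i.
    by apply: eq_bigr => j _; rewrite /c liftK.
  by rewrite subrK.
- rewrite big_ord_recl /c /p unlift_none scaler0 add0r mulmx_sum_row.
  by apply: eq_bigr => j _; rewrite liftK rowE.
Qed.

Lemma coord_measureE d (U : 'M[int]_(d, n)) (Y : set 'rV[R]_n) :
  coord_measure U Y = fine (lebesgue_rV (chart U 0 Y)).
Proof.
rewrite /coord_measure /lebesgue_rV; congr (fine (lebesgue_tuple _)).
apply/seteqP; split => t; rewrite /chart /= add0r mulmx_sum_row;
rewrite (_ : \sum_i tnth t i *: map_mx intr (row i U) =
  \sum_i tuple_row t 0 i *: row i (intmx R U))//;
by apply: eq_bigr => i _; rewrite map_row mxE.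
Qed.

(** The basis selected in the definition of the lattice volume differs from U by a
    unimodular matrix, and the unit simplex has coordinate measure 1/d!. *)
Lemma lattice_volume_chart X d (U : 'M[int]_(d, n)) w : X !=set0 ->
  lattice_chart (aff_hull X) U -> aff_hull X w -> measurable_rV (chart U w X) ->
  lattice_volume X = d`!%:R * fine (lebesgue_rV (chart U w X)).
Proof.
move=> X0 cX Aw mX; have [sU cU] := cX.
have Ab : aff_hull X (base_point (aff_hull X)) by apply: base_point_in; exists w.
have dX := aff_dim_chart X0 cX.
rewrite /lattice_volume; move: dX; move: (aff_dim X) => d' dX; subst d'.
set b := base_point _ in Ab *.
rewrite (recenter_chart cX Ab).
set U' := xget _ _.
have bU' : Zbasis (lattice_points (rowset (intmx R U))) U'.
  by apply: xgetPex; exists U; exact: saturated_Zbasis.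
have [C uC U'E] := Zbasis_unimodular sU bU'.
rewrite !coord_measureE.
have -> : chart U' 0 (recenter X b) = chart U' b X.
  apply/seteqP; split => t; rewrite /chart /= add0r.
    by move=> [y Xy <-]; rewrite addrC subrK.
  by move=> Xt; exists (b + t *m intmx R U') => //; rewrite addrC addKr.
have -> : chart U' 0 (unit_simplex U') = std_simplex R d.
  have sU' : saturated U' by rewrite U'E; exact: saturated_unimodular.
  by apply/seteqP; split => t; rewrite /chart /= add0r => /(unit_simplex_coords t sU').
rewrite lebesgue_rV_simplex /= invrK mulrC U'E.
by have [_ ->] := chart_change uC ((cU w Aw b).1 Ab) mX.
Qed.

End Volume.

(** * An affine hyperplane and its lattice *)

Section AffCharts.
Context {R : realType} {n : nat}.
Implicit Types (x y v w : 'rV[R]_n) (A X F : set 'rV[R]_n).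

Lemma aff_hull_sub_chart A d (U : 'M[int]_(d, n)) X w : lattice_chart A U -> A w ->
  X `<=` A -> aff_hull X `<=` A.
Proof.
move=> [_ cA] Aw XA x [k [p [c [Xp c1 ->]]]]; apply/(cA w Aw)/rowsetP.
have -> : \sum_i c i *: p i - w = \sum_i c i *: (p i - w).
  under [RHS]eq_bigr do rewrite scalerBr.
  by rewrite sumrB -scaler_suml c1 scale1r.
apply: summx_sub => i _; apply: scalemx_sub.
by apply/rowsetP/(cA w Aw)/XA.
Qed.
End AffCharts.

(** Below, H is the hyperplane a = b of the affine space A, the point f0 lies on H
    and the point v in A outside H; U and W are lattice bases of the directions of
    A and H. *)
Section AffineHyperplane.
Context {R : realType} {n k d : nat}.
Variables (A H : set 'rV[R]_n) (U : 'M[int]_(d, n)) (W : 'M[int]_(k, n)).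
Hypotheses (cA : lattice_chart A U) (cH : lattice_chart H W).
Variables (a : 'cV[R]_n) (b : R) (f0 v : 'rV[R]_n).
Hypotheses (HA : H `<=` A) (HE : forall x, A x -> (H x <-> lform a x = b)).
Hypotheses (Hf0 : H f0) (Av : A v) (nHv : ~ H v).

Lemma hyperplane_directions x :
  rowset (intmx R W) x <-> rowset (intmx R U) x /\ lform a x = 0.
Proof.
have Af0 := HA Hf0; have af0 := (HE Af0).1 Hf0.
have EH : rowset (intmx R W) x <-> H (f0 + x).
  by rewrite (cH.2 f0 Hf0) addrC addKr.
have EA : rowset (intmx R U) x <-> A (f0 + x).
  by rewrite (cA.2 f0 Af0) addrC addKr.
rewrite EH EA; split.
  move=> h; have h' := HA h; split => //.
  by have := (HE h').1 h; rewrite lformD af0; lra.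
by move=> [h ax]; apply/HE => //; rewrite lformD af0 ax addr0.
Qed.

(** Together with v - f0, the rows of W form a basis of the row space of U. *)
Lemma hyperplane_codim1 : d = k.+1.
Proof.
have Af0 := HA Hf0; have af0 := (HE Af0).1 Hf0.
pose u := v - f0.
have au : lform a u != 0.
  by rewrite lformB af0 subr_eq0; apply/eqP => /(HE Av).2.
have Uu : rowset (intmx R U) u by apply/(cA.2 f0 Af0).
pose B : 'M[R]_(1 + k, n) := col_mx u (intmx R W).
have fB : row_free B.
  apply: inj_row_free => s; rewrite -[s]hsubmxK mul_row_col => sB.
  have W0 : rowset (intmx R W) (rsubmx s *m intmx R W) by exists (rsubmx s).
  have aW := ((hyperplane_directions _).1 W0).2.
  have s1 : lsubmx s = 0.
    have := congr1 (lform a) sB.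
    rewrite lformD aW addr0 [lsubmx s]mx11_scalar mul_scalar_mx lformZ linear0.
    by move=> /eqP; rewrite mulf_eq0 (negbTE au) orbF => /eqP ->; rewrite raddf0.
  move: sB; rewrite s1 mul0mx add0r -[RHS](mul0mx _ (intmx R W)).
  by move=> /(row_free_inj (saturated_row_free cH.1)) ->; rewrite row_mx0.
have EB : (intmx R U :=: B)%MS.
  apply/eqmxP/andP; split; last first.
    rewrite col_mx_sub; apply/andP; split; first exact/rowsetP.
    apply/row_subP => i; apply/rowsetP.
    apply: ((hyperplane_directions _).1 _).1.
    by exists (delta_mx 0 i) => //; rewrite rowE.
  apply/row_subP => i; set x := row i _.
  have Ux : rowset (intmx R U) x by apply/rowsetP/row_sub.
  have Wx : rowset (intmx R W) (x + (- (lform a x / lform a u)) *: u).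
    apply/hyperplane_directions; split; first exact: rowset_linear.
    by rewrite lformD lformZ mulNr divfK// subrr.
  rewrite -[x](addrK ((- (lform a x / lform a u)) *: u)).
  apply: addmx_sub.
    by apply: (submx_trans ((rowsetP _ _).1 Wx)); rewrite -addsmxE addsmxSr.
  by rewrite -addsmxE; apply: submx_trans (addsmxSl _ _); rewrite eqmx_opp scalemx_sub.
have := saturated_row_free (R := R) cA.1.
by rewrite /row_free EB => /eqP <-; apply/eqP.
Qed.

(** With s = (a(x) - b) / (a(v) - b) the point x' = x - s (v - f0) lies on H, and
    x = x' + s v - s f0. *)
Lemma aff_hull_apex : aff_hull (v |` H) = A.
Proof.
have Af0 := HA Hf0; have af0 := (HE Af0).1 Hf0.
have av : lform a v - b != 0 by rewrite subr_eq0; apply/eqP => /(HE Av).2.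
apply/seteqP; split.
  apply: (aff_hull_sub_chart cA Af0) => x [->//|]; exact: HA.
move=> x Ax; pose s := (lform a x - b) / (lform a v - b).
pose x' := x - s *: (v - f0).
have Hx' : H x'.
  apply/HE; last by rewrite lformB lformZ lformB af0 /s divfK//; ring.
  apply/(cA.2 f0 Af0); rewrite /x' addrAC -scaleNr; apply: rowset_linear.
    exact/(cA.2 f0 Af0).
  exact/(cA.2 f0 Af0).
pose p (i : 'I_3) := nth 0 [:: x'; v; f0] i.
pose c (i : 'I_3) := nth 0 [:: 1; s; - s] i.
exists 3, p, c; split.
- by move=> i; rewrite /p; case: i => -[|[|[|?]]] /= ? //; [right|left|right].
- by rewrite 3!big_ord_recl big_ord0 /c /=; ring.
- rewrite 3!big_ord_recl big_ord0 /c /p /= scale1r addr0 scaleNr -scalerBr.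
  by rewrite /x' subrK.
Qed.

End AffineHyperplane.

Section Height.
Context {R : realType} {n k : nat}.
Variables (A H : set 'rV[R]_n) (U : 'M[int]_(k.+1, n)) (W : 'M[int]_(k, n)).
Hypotheses (cA : lattice_chart A U) (cH : lattice_chart H W).
Variables (a : 'cV[R]_n) (b : R) (f0 v : 'rV[R]_n).
Hypotheses (HA : H `<=` A) (HE : forall x, A x -> (H x <-> lform a x = b)).
Hypotheses (Hf0 : H f0) (Av : A v) (nHv : ~ H v).

(** Existence comes from [primitive_form_hyperplane]. For whichever form the
    definition selects, its constant b is the value at f0 relative to the base
    point, so the base point cancels. *)
Lemma lattice_height_form : exists f : {scalar 'rV[R]_n},
  [/\ primitive_form (lattice_points (rowset (intmx R U))) f,
      forall x, A x -> (H x <-> f x = f f0) &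
      lattice_height_aff H v = `|f v - f f0|].
Proof.
have Af0 := HA Hf0.
rewrite /lattice_height_aff; case: (pselect (H v)) => [//|nH /=].
rewrite (aff_hull_apex cA HA HE Hf0 Av nHv).
have Aw : A (base_point A) by apply: base_point_in; exists v.
set w := base_point A in Aw *.
rewrite (recenter_chart cA Aw).
set S := [set h | _].
have [h Sh] : exists h, S h.
  have WU : (intmx R W <= intmx R U)%MS.
    apply/row_subP => i; apply/rowsetP.
    apply: ((hyperplane_directions cA cH HA HE Hf0 _).1 _).1.
    by exists (delta_mx 0 i) => //; rewrite rowE.
  have [f [pf fE]] := primitive_form_hyperplane cA.1 (saturated_row_free cH.1) WU.
  exists `|f (v - w) - f (f0 - w)|, f, (f (f0 - w)); split => //.
  apply/seteqP; split => x.
    move=> [y Hy <-]; have Ay := HA Hy; split; first exact/(cA.2 w Aw).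
    have Uy : rowset (intmx R U) (y - f0) by apply/(cA.2 f0 Af0).
    have := (fE _ Uy).1 ((cH.2 f0 Hf0 y).1 Hy).
    by rewrite /= !linearB /=; lra.
  move=> [Ux /= fx]; exists (x + w); last by rewrite addrK.
  have Axw : A (x + w) by apply/(cA.2 w Aw); rewrite addrK.
  apply/(cH.2 f0 Hf0)/fE; first exact/(cA.2 f0 Af0).
  by move: fx; rewrite !linearB linearD /=; lra.
have [f [b' [pf Hw ->]]] := xgetPex 0 (ex_intro _ h Sh).
have b'E : f (f0 - w) = b'.
  have : recenter H w (f0 - w) by exists f0.
  by rewrite Hw => -[].
exists f; split => //; last by rewrite -b'E !linearB /=; congr `|_|; lra.
move=> x Ax; split.
  move=> Hx; have : recenter H w (x - w) by exists x.
  by rewrite Hw => -[_ /=]; rewrite -b'E !linearB /=; lra.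
move=> fx; have : recenter H w (x - w).
  by rewrite Hw; split; [exact/(cA.2 w Aw)|rewrite /= -b'E !linearB /= fx].
by move=> [y Hy] /addIr <-.
Qed.

End Height.

(** The same situation, with H cut out of A by a primitive form f. *)
Section ConeMeasure.
Context {R : realType} {n k : nat}.
Variables (A H : set 'rV[R]_n) (U : 'M[int]_(k.+1, n)) (W : 'M[int]_(k, n)).
Hypotheses (cA : lattice_chart A U) (cH : lattice_chart H W).
Variables (f : {scalar 'rV[R]_n}) (f0 v w : 'rV[R]_n).
Hypotheses (pf : primitive_form (lattice_points (rowset (intmx R U))) f).
Hypotheses (HA : H `<=` A) (HE : forall x, A x -> (H x <-> f x = f f0)).
Hypotheses (Hf0 : H f0) (Av : A v) (nHv : ~ H v) (Aw : A w).

Lemma hyperplane_directions_form x :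
  rowset (intmx R W) x <-> rowset (intmx R U) x /\ f x = 0.
Proof.
have [c fc] := scalar_lform f; rewrite fc.
apply: (hyperplane_directions cA cH (b := f f0) HA _ Hf0) => y Ay.
by rewrite HE// fc.
Qed.

(** If f takes the value 1 at the lattice point z0, then z - f(z) z0 lies in the
    lattice of H for each z in the lattice of A; so z0 completes W to a lattice
    basis, which differs from U by a unimodular matrix. *)
Lemma adapted_basis : exists z0 : 'rV[int]_n,
  [/\ rowset (intmx R U) (intmx R z0), f (intmx R z0) = 1 &
      exists2 C : 'M[int]_k.+1, C \in unitmx &
        (col_mx z0 W : 'M[int]_(1 + k, n)) = C *m U].
Proof.
have [fint [z0 Lz0 fz0]] := pf.
exists z0; split => //.
apply: (Zbasis_unimodular (R := R) cA.1).
have colE (c : 'rV[int]_(1 + k)) :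
    c *m col_mx z0 W = lsubmx c 0 0 *: z0 + rsubmx c *m W.
  by rewrite -{1}[c]hsubmxK mul_row_col {1}[lsubmx c]mx11_scalar mul_scalar_mx.
have WU x : rowset (intmx R W) x -> rowset (intmx R U) x.
  by move=> /hyperplane_directions_form[].
have rW (s : 'rV[int]_k) : rowset (intmx R W) (intmx R (s *m W)).
  by exists (intmx R s) => //; rewrite map_mxM.
have sc (i : int) : intmx R (i *: z0) = i%:~R *: intmx R z0.
  by apply/rowP => j; rewrite !mxE intrM.
have fcol (c : 'rV[int]_(1 + k)) : f (intmx R (c *m col_mx z0 W)) = (lsubmx c 0 0)%:~R.
  rewrite colE map_mxD linearD /= sc linearZ /= fz0 mulr1.
  by have [_ ->] := (hyperplane_directions_form _).1 (rW (rsubmx c)); rewrite addr0.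
split.
- move=> c _; rewrite /lattice_points /= colE map_mxD sc addrC.
  by apply: rowset_linear => //; apply: WU.
- suff inj (c c' : 'rV[int]_(1 + k)) : c *m col_mx z0 W = c' *m col_mx z0 W -> c = c'.
    by move=> c c' _ _; exact: inj.
  move=> E.
  have e1 : lsubmx c = lsubmx c'.
    apply/matrixP => i j; rewrite !ord1.
    by have := fcol c; rewrite E fcol => /intr_inj.
  move: E; rewrite !colE e1 => /addrI E.
  have [_ iW _] := saturated_Zbasis (R := R) cH.1.
  have e2 := iW _ _ (in_setT _) (in_setT _) E.
  by rewrite -(hsubmxK c) -(hsubmxK c') e1 e2.
- move=> z Lz.
  have /intrP[i fi] : f (intmx R z) \is a Num.int by exact: fint.
  have [_ _ sW] := saturated_Zbasis (R := R) cH.1.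
  have : lattice_points (rowset (intmx R W)) (z - i *: z0).
    apply/hyperplane_directions_form; rewrite map_mxB sc; split.
      by rewrite -scaleNr; exact: rowset_linear.
    by rewrite linearB /= linearZ /= fz0 mulr1 fi subrr.
  move=> /sW[s _ /= sE]; exists (row_mx i%:M s) => //.
  by rewrite (@mul_row_col _ 1 1 k) mul_scalar_mx sE addrC subrK.
Qed.

(** In the adapted coordinates with origin v the first coordinate is f - f(v), so
    the pyramid has its apex at 0 and its base at height f(f0) - f(v). *)
Lemma lebesgue_rV_chart_cone F : F `<=` H ->
  measurable_rV (chart W f0 F) -> measurable_rV (chart U w (cone v F)) ->
  lebesgue_rV (chart U w (cone v F)) =
  ((`|f v - f f0| / k.+1%:R)%:E * lebesgue_rV (chart W f0 F))%E.
Proof.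
move=> FH mF mC.
have [z0 [Uz0 fz0 [C uC EC]]] := adapted_basis.
have Uvw : rowset (intmx R U) (v - w) by apply/(cA.2 w Aw).
have [mC' <-] := chart_change uC Uvw mC.
rewrite -EC in mC' *.
pose h := f f0 - f v.
have h0 : h != 0.
  by rewrite subr_eq0; apply/eqP => E; apply: nHv; apply/HE.
have Af0 := HA Hf0.
have [p0 _ pE] : rowset (intmx R W) (v + h *: intmx R z0 - f0).
  apply/hyperplane_directions_form; split.
    rewrite addrAC; apply: rowset_linear => //; exact/(cA.2 f0 Af0).
  by rewrite linearB linearD /= linearZ /= fz0 mulr1 /h; ring.
rewrite distrC; apply: (lebesgue_rV_cone (p := p0)) => // x y x0.
have E : v + row_cons x y *m intmx R (col_mx z0 W : 'M[int]_(1 + k, n)) =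
    v + (x *: intmx R z0 + y *m intmx R W).
  by rewrite map_col_mx (@mul_row_col _ 1 1 k) mul_scalar_mx.
have fW s : f (s *m intmx R W) = 0.
  have Ws : rowset (intmx R W) (s *m intmx R W) by exists s.
  by have [] := (hyperplane_directions_form _).1 Ws.
have fH u : F u -> f u = f f0 by move=> /FH Hu; apply/HE => //; exact: HA.
rewrite /chart /= E.
have key : f0 + ((h / x) *: y + p0) *m intmx R W =
    v + (h / x) *: (x *: intmx R z0 + y *m intmx R W).
  rewrite mulmxDl pE -scalemxAl scalerDr scalerA divfK//.
  by rewrite addrCA [f0 + _]addrC subrK addrC addrA.
split.
  move=> [s [u [/andP[s0 s1] Fu]]] /addrI xE.
  have xs : x = s * h.
    have := congr1 f xE.
    by rewrite linearD !linearZ /= fz0 fW linearB /= fH// /h; lra.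
  have sn0 : s != 0 by apply: contraNneq x0 => s0'; rewrite xs s0' mul0r.
  have sx : s = x / h by rewrite xs mulfK.
  split; first by rewrite -sx s1 lt_neqAle eq_sym sn0 s0.
  rewrite key xE (_ : h / x = s^-1); last by rewrite sx invfM invrK mulrC.
  by rewrite scalerA mulVf// scale1r addrC subrK.
move=> [/andP[xh0 xh1] Fu].
exists (x / h), (f0 + ((h / x) *: y + p0) *m intmx R W); split => //.
  by rewrite (ltW xh0).
rewrite key addrAC subrr add0r scalerA.
by rewrite mulrA divfK// divff// scale1r.
Qed.

End ConeMeasure.

(** * The volume formula *)

Section AlmostDisjoint.
Context d (T : measurableType d) (R : realType) (mu : {measure set T -> \bar R}).

Lemma measure_bigsetU_null (I : Type) (s : seq I) (E : I -> set T) :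
  (forall i, measurable (E i)) -> (forall i, mu (E i) = 0%E) ->
  mu (\big[setU/set0]_(i <- s) E i) = 0%E.
Proof.
move=> mE E0; elim: s => [|i s IH]; first by rewrite big_nil measure0.
rewrite big_cons measureU0//; exact: bigsetU_measurable.
Qed.

Lemma measure_almost_disjoint (I : eqType) (s : seq I) (C : I -> set T) :
  uniq s -> (forall i, i \in s -> measurable (C i)) ->
  (forall i j, i \in s -> j \in s -> i != j -> mu (C i `&` C j) = 0%E) ->
  mu (\big[setU/set0]_(i <- s) C i) = (\sum_(i <- s) mu (C i))%E.
Proof.
elim: s => [|i s IH]; first by rewrite !big_nil measure0.
move=> /= /andP[nis us] mC C0; rewrite !big_cons.
have mCi : measurable (C i) by apply: mC; rewrite inE eqxx.
have mCs j : j \in s -> measurable (C j) by move=> js; apply: mC; rewrite inE js orbT.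
set B := \big[setU/set0]_(j <- s) C j.
have mB : measurable B by rewrite /B big_seq; exact: bigsetU_measurable.
have B0 : mu (B `&` C i) = 0%E.
  rewrite /B big_distrl /= big_seq_cond.
  rewrite (eq_bigr (fun j => if j \in s then C j `&` C i else set0)); last first.
    by move=> j /andP[-> _].
  rewrite -big_seq_cond; apply: measure_bigsetU_null => j; case: ifPn => // js.
  - by apply: measurableI => //; exact: mCs.
  - apply: C0; rewrite ?inE ?js ?eqxx ?orbT//; apply: contraNneq nis => <-//.
rewrite setUC -(setDUK (@subsetUr _ B (C i))) setUC.
have -> : (B `|` C i) `\` C i = B `\` C i by rewrite setDUl setDv setU0.
rewrite measureU//; last 2 first.
- exact: measurableD.
- by rewrite setDE -setIA setICl setI0.
rewrite addeC; congr (_ + _)%E.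
rewrite -IH//; last first.
  by move=> j l js ls; apply: C0; rewrite inE ?js ?ls orbT.
rewrite -/B [in RHS](measureDI mu mB mCi) [X in (_ + X)%E](_ : _ = 0%E) ?adde0//.
Qed.
End AlmostDisjoint.

Section Assembly.
Context {R : realType} {n m : nat}.
Variable q : 'I_m -> 'rV[rat]_n.
Let qR (i : 'I_m) : 'rV[R]_n := map_mx ratr (q i).
Local Notation P := (conv_hull (range qR)).
Variables (k : nat) (U : 'M[int]_(k.+1, n)) (v : 'rV[R]_n).
Hypotheses (cP : lattice_chart (aff_hull P) U) (Pv : P v).
Let Av : aff_hull P v. Proof. exact: aff_hull_self. Qed.

Lemma lebesgue_rV_chart_null S (g : 'cV[R]_n) :
  (exists2 x, aff_hull P x & lform g x <> lform g v) ->
  measurable_rV (chart U v S) -> S `<=` [set x | lform g x = lform g v] ->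
  lebesgue_rV (chart U v S) = 0%E.
Proof.
move=> [x Ax gx] mS Sg.
have E t : lform g (v + t *m intmx R U) = lform g v + (t *m (intmx R U *m g)) 0 0.
  by rewrite lformD; congr (_ + _); rewrite /lform mulmxA.
have g0 : intmx R U *m g != 0.
  apply/eqP => g0; apply: gx.
  have [t _ tE] := (cP.2 v Av x).1 Ax.
  by rewrite -(subrK v x) -tE addrC E g0 mulmx0 mxE addr0.
apply/eqP; rewrite eq_le lebesgue_rV_ge0 andbT -(lebesgue_rV_hyperplane 0 g0).
apply: lebesgue_rV_mono => //; first exact: measurable_rV_hyperplane.
move=> t /Sg /=; rewrite E => h.
by apply: (addrI (lform g v)); rewrite h addr0.
Qed.

Lemma measurable_rV_chart_cone l (p : 'I_l -> 'rV[R]_n) : conv_hull (range p) !=set0 ->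
  measurable_rV (chart U v (cone v (conv_hull (range p)))).
Proof.
case: l p => [|l] p.
  move=> [x /conv_hull_rangeP[c [_]]]; rewrite big_ord0 => /eqP.
  by rewrite eq_sym oner_eq0.
by move=> _; rewrite cone_conv; exact: measurable_rV_chart_conv.
Qed.

(** Both sides vanish when v lies in the affine hull of F. Otherwise the height of
    v over F is the height of the pyramid in adapted coordinates, and the factor
    1/d of the pyramid formula is (d-1)!/d!, the quotient of the normalizations
    for F and P. *)
Lemma lebesgue_rV_chart_facet_cone F : facets P F -> F !=set0 ->
  lebesgue_rV (chart U v (cone v F)) =
  ((lattice_height F v * lattice_volume F) / (k.+1)`!%:R)%:E.
Proof.
move=> fF F0.
have FC := face_gens fF.1.1.
have mcone : measurable_rV (chart U v (cone v F)).
  by rewrite {1}FC; apply: measurable_rV_chart_cone; rewrite -FC.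
have [Fv|nFv] := pselect (aff_hull F v).
  rewrite /lattice_height /lattice_height_aff; case: pselect => //= _.
  have [g [gA gF]] := cone_in_hyperplane fF F0 Pv Fv.
  by rewrite (lebesgue_rV_chart_null gA)// !mul0r.
have [a [b [ab FE _ aE]]] := facet_hyperplane fF F0.
have [f0 Ff0] := F0.
have [i0 _] : exists i0 : 'I_#|gens qR F|, True.
  move: Ff0; rewrite {1}FC => /conv_hull_rangeP[c [_ + _]].
  case: #|_| c => [|l] c; last by move=> _; exists ord0.
  by rewrite big_ord0 => /eqP; rewrite eq_sym oner_eq0.
have [d [W cW]] := polytope_lattice_chart (R := R) (subfam q (gens qR F)) i0.
have {}cW : lattice_chart (aff_hull F) W by rewrite FC.
have HA : aff_hull F `<=` aff_hull P by exact/aff_hull_sub/facet_sub.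
have Hf0 : aff_hull F f0 by exact: aff_hull_self.
have [dk] : k.+1 = d.+1 := hyperplane_codim1 cP cW HA aE Hf0 Av nFv.
subst d.
have [f [pf fE hE]] := lattice_height_form cP cW HA aE Hf0 Av nFv.
have mF : measurable_rV (chart W f0 F) by rewrite FC; exact: measurable_rV_chart_conv.
rewrite (lebesgue_rV_chart_cone cP cW pf HA fE Hf0 Av nFv Av
  (@aff_hull_self _ _ F) mF mcone).
rewrite /lattice_height hE (lattice_volume_chart F0 cW Hf0 mF).
have Ffin : lebesgue_rV (chart W f0 F) \is a fin_num.
  rewrite ge0_fin_numE ?lebesgue_rV_ge0// FC.
  by apply: lebesgue_rV_chart_lty; exact: cW.1.
rewrite -{1}(fineK Ffin) -EFinM; congr EFin.
rewrite factS natrM; field; apply/andP; split; last by rewrite addrC natr1 pnatr_eq0.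
by rewrite pnatr_eq0 -lt0n fact_gt0.
Qed.

Lemma polytope_volume_facets x0 : P x0 -> x0 <> v ->
  lattice_volume P = \sum_(F \in facets P) lattice_height F v * lattice_volume F.
Proof.
move=> Px0 x0v.
have fin := finite_facets qR.
have F0 F : facets P F -> F !=set0 by exact: facet_nonempty Pv Px0 x0v.
have mcone F : facets P F -> measurable_rV (chart U v (cone v F)).
  move=> fF; rewrite {1}(face_gens fF.1.1); apply: measurable_rV_chart_cone.
  by rewrite -(face_gens fF.1.1); exact: F0.
have mP := measurable_rV_chart_conv U v qR.
have P0 : P !=set0 by exists v.
rewrite (lattice_volume_chart P0 cP Av mP).
rewrite (fsbig_finite _ _ fin) /=.
have sE F : F \in finmap.enum_fset (fset_set (facets P)) -> facets P F.
  by rewrite in_fset_set// => /set_mem.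
have -> : lebesgue_rV (chart U v P) =
    (\sum_(F <- finmap.enum_fset (fset_set (facets P)))
      lebesgue_rV (chart U v (cone v F)))%E.
  have E : [set t | chart U v P (tuple_row t)] =
      \big[setU/set0]_(F <- finmap.enum_fset (fset_set (facets P)))
        [set t | chart U v (cone v F) (tuple_row t)].
    rewrite -bigcup_fset_set//; apply/seteqP; split => t.
      by rewrite /chart /= {1}(facet_cones_cover Pv Px0 x0v) => -[F fF cF]; exists F.
    by move=> [F fF cF]; rewrite /chart /=; exact: cone_sub_polytope cF.
  rewrite /lebesgue_rV E measure_almost_disjoint//.
  - by move=> F /sE; exact: mcone.
  move=> F F' /sE fF /sE fF' /eqP FF'.
  have mI : measurable_rV (chart U v (cone v F `&` cone v F')).
    exact: measurableI (mcone _ fF) (mcone _ fF').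
  apply: (etrans _ (_ : lebesgue_rV (chart U v (cone v F `&` cone v F')) = 0%E)) => //.
  have [Fv|nFv] := pselect (aff_hull F v).
    have [g [gA gF]] := cone_in_hyperplane fF (F0 _ fF) Pv Fv.
    by apply: (lebesgue_rV_chart_null gA) => // x [/gF].
  have [F'v|nF'v] := pselect (aff_hull F' v).
    have [g [gA gF]] := cone_in_hyperplane fF' (F0 _ fF') Pv F'v.
    by apply: (lebesgue_rV_chart_null gA) => // x [_ /gF].
  have [g [gA gF]] := facet_cones_overlap Pv fF fF' (F0 _ fF) (F0 _ fF') FF' nFv nF'v.
  exact: (lebesgue_rV_chart_null gA).
rewrite big_seq.
rewrite (eq_bigr (fun F =>
  ((lattice_height F v * lattice_volume F) / (k.+1)`!%:R)%:E)); last first.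
  by move=> F /sE fF; apply: lebesgue_rV_chart_facet_cone => //; exact: F0.
by rewrite -big_seq sumEFin /= -mulr_suml mulrC divfK.
Qed.

End Assembly.

Theorem proposition1 (R : realType) (n : nat) (P : set 'rV[R]_n) (v : 'rV[R]_n)
    (ratP : rational_polytope P) (dimP : (1 <= aff_dim P)%N) (Pv : P v) :
  lattice_volume P =
    \sum_(F \in facets P) lattice_height F v * lattice_volume F.
Proof.
have [m [q PE]] := rational_generators ratP; subst P.
case: m q => [|m] q in ratP dimP Pv *.
  move: Pv => /conv_hull_rangeP[c [_]]; rewrite big_ord0 => /eqP.
  by rewrite eq_sym oner_eq0.
have [d [U cU]] := polytope_lattice_chart (R := R) q ord0.
set qR := fun i => _ in cU ratP dimP Pv *.
have P0 : conv_hull (range qR) !=set0 by exists v.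
have dE := aff_dim_chart P0 cU.
case: d U cU dE => [|k] U cU dE; first by move: dimP; rewrite dE.
have [x0 Px0 x0v] : exists2 x0, conv_hull (range qR) x0 & x0 <> v.
  (* Otherwise P = {v}, whereas the row space of U has positive dimension. *)
  apply: contrapT => h.
  have qv i : qR i = v.
    by apply: contrapT => hi; apply: h; exists (qR i) => //; exact: gen_in.
  have Av : aff_hull (conv_hull (range qR)) v by exact: aff_hull_self.
  have [V UV] := cU.1.
  pose u := row ord0 (map_mx (intr : int -> R) U).
  have : aff_hull (conv_hull (range qR)) (v + u).
    apply/(cU.2 v Av); rewrite addrC addKr; exists (delta_mx 0 ord0) => //.
    by rewrite -rowE.
  rewrite (aff_conv_rowspace qR ord0) qv addrC addKr => /submxP[t].
  rewrite (_ : \matrix_i _ = 0) ?mulmx0; last first.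
    by apply/row_matrixP => i; rewrite rowK row0 !qv subrr.
  move=> u0; have := saturated_row_free (R := R) cU.1 => /row_freeP[B UB].
  have := congr1 (fun M : 'M[R]_k.+1 => row ord0 M) UB; rewrite row_mul -/u u0 mul0mx.
  by move=> /rowP/(_ ord0)/eqP; rewrite !mxE eqxx eq_sym oner_eq0.
exact: (@polytope_volume_facets R n m.+1 q k U v cU Pv x0 Px0 x0v).
Qed.
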